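(* Let $J\subset\mathbb R\times\{0\}$ be an open interval containing the origin. Let $F$ be one of the two maps $$\text{(I)}\ \ F(\tau,h)=(\tau+\sqrt h,\ h)\qquad\text{or}\qquad\text{(II)}\ \ F(\tau,h)=(\tau+h,\ h)$$ of the half-plane $\mathbb R_\tau\times(\mathbb R_{\ge0})_h$. Every germ at $J$ of $C^\infty$-smooth foliation $\mathcal F$ by $F$-invariant curves is defined by a unique germ at $S^1\times\{0\}$ of $C^\infty$-smooth $h$-flat function $\psi(t,h)$, $\psi:S^1\times\mathbb R_{\ge0}\to\mathbb R$, $S^1=\mathbb R/\mathbb Z$, with $\psi(0,h)=0$, so that $\mathcal F$ is the foliation by level curves of the function $$g(\tau,h)=h+\psi\left(\frac{\tau}{\sqrt h},h\right)\ \text{ in case (I)},\qquad g(\tau,h)=h+\psi\left(\frac{\tau}{h},h\right)\ \text{ in case (II)}.$$ Conversely, each germ at $S^1\times\{0\}$ of $C^\infty$-smooth $h$-flat function $\psi(t,h)$, $\psi:S^1\times\mathbb R_{\ge0}\to\mathbb R$, with $\psi(0,h)=0$, defines in this way a germ at $J$ of $C^\infty$-smooth foliation by $F$-invariant curves.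
   Context: A domain $U\subset\mathbb R\times\mathbb R_+$ is adjacent to $J$ if $J\subset\partial U$ and $U\cup J$ contains a neighborhood in $\mathbb R\times\mathbb R_{\ge0}$ of each point of $J$. A foliation by $F$-invariant curves is the $C^\infty$-smooth foliation on $U\cup J$ ($U$ a domain adjacent to $J$), with $J$ being a leaf, by connected components of level curves of a $C^\infty$-smooth function $k:U\cup J\to\mathbb R_{\ge0}$ with $k|_J\equiv0$, $\frac{\partial k}{\partial h}>0$, that is $F$-invariant: $k(F(x))=k(x)$ whenever $x,F(x)\in U\cup J$. Germs at $J$: two foliations define the same germ at $J$ if they coincide on $U'\cup J$ for some domain $U'$ adjacent to $J$. A $C^\infty$-smooth function $\psi(t,h)$ near $S^1\times\{0\}$ in $S^1\times\mathbb R_{\ge0}$ is $h$-flat if it tends to zero with all its partial derivatives as $h\to0$, uniformly in $t\in S^1$. It is treated as a function $1$-periodic in $t$. *)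

(* Defs.v *)
From HB Require Import structures.
From mathcomp Require Import all_boot all_order all_algebra.
From mathcomp Require Import all_classical all_reals all_analysis.
Set Implicit Arguments.
Unset Strict Implicit.
Unset Printing Implicit Defensive.
Import Order.TTheory GRing.Theory Num.Theory.
Import numFieldNormedType.Exports.
Local Open Scope classical_set_scope.
Local Open Scope ring_scope.

(* Points of the (tau, h)-plane, and of the (t, h)-plane, are pairs p : R * R
   with p.2 = h. A function on a subset S of the plane is given by a total
   function on R * R, of which only the values on S matter. *)

Section SmoothFunctions.
Variable R : realType.
Implicit Types (S : set (R * R)) (f : R * R -> R) (p : R * R) (l : R).

(* The increments r are restricted to those that stay in S, so these
   derivatives are one-sided in h at the boundary points h = 0. *)
Definition has_partial1 S f p l : Prop :=
  (f (p.1 + r, p.2) - f p) / r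
    @[r --> within [set r | S (p.1 + r, p.2)] 0^'] --> l.

Definition has_partial2 S f p l : Prop :=
  (f (p.1, p.2 + r) - f p) / r
    @[r --> within [set r | S (p.1, p.2 + r)] 0^'] --> l.

(* D i j is the partial derivative of f of order i in the first variable and j
   in the second one; all of them exist and are continuous on S, including the
   points of S with h = 0. *)
Definition partial_derivatives S f (D : nat -> nat -> R * R -> R) : Prop :=
  (forall p, S p -> D 0%N 0%N p = f p) /\
  (forall i j, [/\ {within S, continuous (D i j)},
     forall p, S p -> has_partial1 S (D i j) p (D i.+1 j p) &
     forall p, S p -> has_partial2 S (D i j) p (D i j.+1 p)]).

Definition smooth_on S f : Prop := exists D, partial_derivatives S f D.

End SmoothFunctions.

Section FlatFunctions.
Variable R : realType.
Implicit Types (psi : R * R -> R) (eps : R).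

Definition strip eps : set (R * R) := [set p | 0 <= p.2 < eps].

(* By compactness of the circle, the strips of R * [0, +oo[ form, modulo
   t |-> t + 1, a basis of neighbourhoods of S^1 * {0}. So a germ at S^1 * {0}
   is represented by a function psi that is 1-periodic in t on some strip. *)
Definition flat_function eps psi : Prop :=
  [/\ 0 < eps,
      forall t h, 0 <= h < eps -> psi (t + 1, h) = psi (t, h),
      forall h, 0 <= h < eps -> psi (0, h) = 0 &
      exists2 D, partial_derivatives (strip eps) psi D &
        forall i j (e : R), 0 < e ->
          \forall h \near 0^'+, forall t, `|D i j (t, h)| < e].

Definition same_function_germ eps1 psi1 eps2 psi2 : Prop :=
  exists eps : R, [/\ 0 < eps, eps <= eps1, eps <= eps2 &
    forall p, strip eps p -> psi1 p = psi2 p].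

End FlatFunctions.

Section Foliations.
Variable R : realType.
Implicit Types (J : set R) (U S : set (R * R)) (k : R * R -> R).

Definition axis J : set (R * R) := J `*` [set 0].

Definition adjacent J U : Prop :=
  [/\ open U, connected U, U `<=` [set p | 0 < p.2],
      axis J `<=` closure U `\` U° &
      forall p, axis J p ->
        \forall q \near p, 0 <= q.2 -> (U `|` axis J) q].

Definition leaf S k (p : R * R) : set (R * R) :=
  connected_component (S `&` [set q | k q = k p]) p.

Definition leaves S k : set (set (R * R)) := [set leaf S k p | p in S].

Definition invariant_foliation (F : R * R -> R * R) J U k : Prop :=
  let S := U `|` axis J in
  adjacent J U /\
  [/\ smooth_on S k,
      forall p, S p -> 0 <= k p,
      forall p, axis J p -> k p = 0,
      forall p, S p -> exists2 l, has_partial2 S k p l & 0 < l &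
      forall p, S p -> S (F p) -> k (F p) = k p] /\
  leaves S k (axis J).

(* For U' contained in U, the leaves of the restriction to U' `|` axis J of the
   foliation given by (U, k) are the connected components of the level sets of
   k in U' `|` axis J. *)
Definition same_foliation_germ J U1 k1 U2 k2 : Prop :=
  exists U, [/\ adjacent J U, U `<=` U1, U `<=` U2 &
    leaves (U `|` axis J) k1 = leaves (U `|` axis J) k2].

End Foliations.

Variant map_case := CaseI | CaseII.

Section MainObjects.
Variables (R : realType) (c : map_case).

Definition shift_length (h : R) : R :=
  match c with CaseI => Num.sqrt h | CaseII => h end.

Definition Fmap (p : R * R) : R * R := (p.1 + shift_length p.2, p.2).

(* At h = 0 the quotient is 0 by convention and gfun psi (tau, 0) = psi (0, 0);
   this is 0, the continuous extension, as soon as psi (0, h) = 0. *)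
Definition gfun (psi : R * R -> R) (p : R * R) : R :=
  p.2 + psi (p.1 / shift_length p.2, p.2).

(* The level curves of gfun psi, near J, form a foliation whose germ at J is
   that of (U, k). *)
Definition defines_germ (J : set R) (eps : R) (psi : R * R -> R)
    (U : set (R * R)) (k : R * R -> R) : Prop :=
  exists V, [/\ V `<=` strip eps, invariant_foliation Fmap J V (gfun psi) &
    same_foliation_germ J V (gfun psi) U k].

End MainObjects.

(* Main.v *)
Require Import Defs.
From mathcomp Require Import all_boot all_order all_algebra.
From mathcomp Require Import all_classical all_reals all_analysis.
From mathcomp Require Import zify ring lra.
Import Order.TTheory GRing.Theory Num.Theory.
Import numFieldNormedType.Exports.
Local Open Scope classical_set_scope.
Local Open Scope ring_scope.
Set Implicit Arguments.
Unset Strict Implicit.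
Unset Printing Implicit Defensive.

(** Write s for the length of the step of F: sqrt h in one case, h in the other.

    From a foliation to a flat function. Let k define the foliation. On the line
    tau = 0 it is strictly increasing in h, and composing it with the inverse of
    h |-> k (0, h) gives a smooth function g with the same level curves and
    g (0, h) = h ([normal_form]). By invariance f = g - h vanishes on the orbits
    of the points (0, h). Their steps s tend to 0 with h, so zeros of f
    accumulate at every point of the axis; Rolle's theorem in h passes this on
    to the next derivative once a derivative is known to vanish on the axis, and
    so all the derivatives of f vanish there ([zeros_vanishing]). Integrating in
    h, they are O(h^N) for every N ([vanishing_decay]). The function
    psi (t, h) = f (t s, h), read off for t in one period and extended
    periodically, is then smooth and flat: differentiating the change of variable
    only costs powers of 1 / h ([foliation_flat_function]).

    From a flat function to a foliation. The converse change of variable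
    t = tau / s also costs only powers of 1 / h, which a flat function absorbs.
    So psi (tau / s, h), extended by 0 to the axis, is smooth and has zero
    derivatives there; adding h gives an invariant function with positive
    derivative in h near the axis ([gfun_foliation]).

    Both changes of variable, as well as the periodization, are handled by one
    calculus of functions of class C^n all of whose derivatives are O(h^N) for
    every N ([flat]), a class that is an ideal for the functions of polynomial
    growth in 1 / h ([moderate]). The families of derivatives that smoothness
    requires are then assembled with the symmetry of second derivatives
    ([Cinfty_smooth]).

    Uniqueness. Near the origin the leaves are graphs over an interval containing
    tau = 0, where the function h + psi (tau / s, h) takes the value h. So the
    leaf through a point determines the value of the function at this point
    ([germ_determines_function]); as s tends to 0, a neighbourhood of the origin
    covers a whole period of psi ([gfun_determines]). *)

Local Notation adjacent := Defs.adjacent.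

(** * Neighbourhoods in the line and in the plane *)

Section Neighbourhoods.
Variable R : realType.
Implicit Types (p q : R * R) (S : set (R * R)) (f : R * R -> R).

Lemma near_planeP (P : set (R * R)) p :
  (\forall q \near p, P q) <->
  exists2 e : R, 0 < e &
    forall q, `|q.1 - p.1| < e -> `|q.2 - p.2| < e -> P q.
Proof.
split.
  move=> /nbhs_ballP[e /= e0 H]; exists e => // q h1 h2; apply: H; split.
    by rewrite /ball /= distrC.
  by rewrite /ball /= distrC.
move=> [e e0 H]; apply/nbhs_ballP; exists e => //= q [h1 h2].
by apply: H; rewrite distrC.
Qed.

Lemma near_lineP (P : set R) x :
  (\forall y \near x, P y) <->
  exists2 e : R, 0 < e & forall y, `|y - x| < e -> P y.
Proof.
split.
  by move=> /nbhs_ballP[e /= e0 H]; exists e => // y h; apply: H; rewrite /ball /= distrC.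
by move=> [e e0 H]; apply/nbhs_ballP; exists e => //= y h; apply: H; rewrite distrC.
Qed.

(** The tube lemma, for a horizontal segment. *)
Lemma tube (P : set (R * R)) (a b y : R) :
  (forall x, a <= x <= b -> \forall q \near (x, y), P q) ->
  exists2 e : R, 0 < e & forall x h, a <= x <= b -> `|h - y| < e -> P (x, h).
Proof.
move=> HP; have := @segment_compact R a b.
move=> /compact_near_coveringP /(_ R (nbhs y) (fun h x => P (x, h)) _).
case.
  move=> x /= xab; have {}xab : a <= x <= b by move: xab; rewrite in_itv.
  move: (HP x xab) => /nbhs_ballP[e /= e0 H].
  exists (ball x e, ball y e) => /=; first by split; exact: nbhsx_ballx.
  by move=> [x' h] /= [h1 h2]; apply: (H (x', h)).
move=> e /= e0 H; exists e => // x h xab he.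
by apply: (H h); rewrite /= ?in_itv //= distrC.
Qed.

Lemma continuous_withinP S f :
  {within S, continuous f} <->
  forall p, S p -> forall e : R, 0 < e -> exists2 d : R, 0 < d &
    forall q, S q -> `|q.1 - p.1| < d -> `|q.2 - p.2| < d -> `|f q - f p| < e.
Proof.
split.
  move=> /subspace_continuousP H p Sp e e0.
  have /cvgrPdist_lt/(_ e e0) := H p Sp.
  rewrite near_withinE => /near_planeP[d d0 K]; exists d => // q Sq h1 h2.
  by rewrite distrC; apply: K.
move=> H; apply/subspace_continuousP => p Sp.
apply/cvgrPdist_lt => e e0; rewrite near_withinE; apply/near_planeP.
by have [d d0 K] := H p Sp e e0; exists d => // q h1 h2 Sq; rewrite distrC; apply: K.
Qed.

(** A set that is relatively open in the closed upper half-plane: the domains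
    with their boundary interval, the strips of the circle, and the open sets
    of the open half-plane are all of this kind. *)
Definition hopen S := forall p, S p ->
  0 <= p.2 /\ \forall q \near p, 0 <= q.2 -> S q.

Lemma hopenP S p : hopen S -> S p -> 0 <= p.2 /\
  exists2 e : R, 0 < e &
    forall q, `|q.1 - p.1| < e -> `|q.2 - p.2| < e -> 0 <= q.2 -> S q.
Proof. by move=> oS /oS[p0 /near_planeP[e e0 H]]; split=> //; exists e. Qed.

End Neighbourhoods.

(** * One-variable difference quotients along a set of increments *)

Section DifferenceQuotients.
Variable R : realType.
Implicit Types (A B : set R) (u v : R -> R) (l : R).

(** Both partial derivatives of a function on a set are limits of this form,
    with A the set of increments that stay in the set. *)
Definition dq A u l : Prop := (u r - u 0) / r @[r --> within A 0^'] --> l.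

Lemma dqP A u l : dq A u l <->
  forall e : R, 0 < e -> exists2 d : R, 0 < d &
    forall r, A r -> r != 0 -> `|r| < d -> `|(u r - u 0) / r - l| < e.
Proof.
split.
  move=> /cvgrPdist_lt H e e0; have := H e e0.
  rewrite near_withinE near_withinE => /near_lineP[d d0 K].
  exists d => // r Ar r0 rd; rewrite distrC; apply: K => //.
  by rewrite subr0.
move=> H; apply/cvgrPdist_lt => e e0; rewrite near_withinE near_withinE.
apply/near_lineP; have [d d0 K] := H e e0; exists d => // r; rewrite subr0.
by move=> rd r0 Ar; rewrite distrC; apply: K.
Qed.

Lemma dq_local A B u v l : u 0 = v 0 ->
  (exists2 d : R, 0 < d & forall r, `|r| < d -> B r -> A r /\ u r = v r) ->
  dq A u l -> dq B v l.
Proof.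
move=> uv0 [d d0 H] /dqP K; apply/dqP => e e0.
have [d' d'0 L] := K e e0; exists (Num.min d d'); first by rewrite lt_min d0.
move=> r Br r0; rewrite lt_min => /andP[rd rd'].
have [Ar uvr] := H r rd Br.
by rewrite -uvr -uv0; apply: L.
Qed.

Lemma dq_unique A u l l' :
  (exists2 d : R, 0 < d & forall r, 0 < r < d -> A r) ->
  dq A u l -> dq A u l' -> l = l'.
Proof.
move=> [d d0 H] H1 H2.
suff PF : ProperFilter (within A (0 : R)^') by exact: (cvg_unique _ H1 H2).
split; last exact: within_filter.
rewrite /within /dnbhs /within /= => /near_lineP[e e0].
pose r := Num.min d e / 2.
have me : 0 < Num.min d e by rewrite lt_min d0.
have r0 : 0 < r by rewrite /r; lra.
have [rd re] : r < d /\ r < e.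
  have : Num.min d e <= d by rewrite ge_min lexx.
  have : Num.min d e <= e by rewrite ge_min lexx orbT.
  by rewrite /r; split; lra.
move=> /(_ r); apply.
- by rewrite subr0 gtr0_norm.
- by rewrite gt_eqF.
- by apply: H; rewrite r0.
Qed.

Lemma cvg_near_eq (F : set_system R) (u v : R -> R) l : Filter F ->
  (\forall r \near F, u r = v r) -> u r @[r --> F] --> l -> v r @[r --> F] --> l.
Proof. by move=> FF H; apply: cvg_trans; exact: near_eq_cvg. Qed.

Lemma dq_cont A u l : dq A u l -> u r @[r --> within A 0^'] --> u 0.
Proof.
move=> H; have F : Filter (within A (0 : R)^') by exact: within_filter.
have H0 : r @[r --> within A (0 : R)^'] --> (0 : R).
  by apply: cvg_within_filter; apply: cvg_within_filter; exact: cvg_id.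
have -> : u 0 = l * 0 + u 0 by rewrite mulr0 add0r.
apply: cvg_near_eq (cvgD (cvgM H H0) (@cvg_cst R (u 0) _ _ F)).
rewrite near_withinE near_withinE; near=> r => r0 _ /=.
by rewrite divfK // subrK.
Unshelve. all: by end_near. Qed.

Lemma dq_cst A c : dq A (fun _ => c) 0.
Proof.
apply/dqP => e e0; exists 1 => // r _ _ _.
by rewrite subrr mul0r subr0 normr0.
Qed.

Lemma dq_shift A c : dq A (fun r => c + r) 1.
Proof.
apply/dqP => e e0; exists 1 => // r _ r0 _.
by rewrite addr0 addrAC subrr add0r divff // subrr normr0.
Qed.

Lemma dqD A u v l m : dq A u l -> dq A v m -> dq A (fun r => u r + v r) (l + m).
Proof.
move=> H1 H2; have F : Filter (within A (0 : R)^') by exact: within_filter.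
apply: cvg_near_eq (cvgD H1 H2); apply: nearW => r /=.
by rewrite -mulrDl; congr (_ / _); ring.
Qed.

Lemma dqM A u v l m : dq A u l -> dq A v m ->
  dq A (fun r => u r * v r) (l * v 0 + u 0 * m).
Proof.
move=> H1 H2; have F : Filter (within A (0 : R)^') by exact: within_filter.
apply: cvg_near_eq (cvgD (cvgM H1 (dq_cont H2))
  (cvgM (@cvg_cst R (u 0) _ _ F) H2)).
by apply: nearW => r /=; ring.
Qed.

Lemma dqV A u l : u 0 != 0 -> dq A u l ->
  dq A (fun r => (u r)^-1) (- l * ((u 0)^-1 * (u 0)^-1)).
Proof.
move=> u0 H; have F : Filter (within A (0 : R)^') by exact: within_filter.
have K : (u r)^-1 @[r --> within A 0^'] --> (u 0)^-1 by apply: cvgV u0 (dq_cont H).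
apply: cvg_near_eq (cvgM (cvgN H) (cvgM K (@cvg_cst R (u 0)^-1 _ _ F))).
have : \forall r \near within A 0^', u r != 0.
  have /cvgrPdist_lt/(_ `|u 0|) := dq_cont H.
  rewrite normr_gt0 => /(_ u0); apply: filterS => r.
  by apply: contraTneq => ->; rewrite subr0 ltxx.
apply: filterS => r ur0.
have -> : (u r)^-1 - (u 0)^-1 = (u 0 - u r) * ((u r)^-1 * (u 0)^-1).
  by field; rewrite ur0 u0.
by rewrite -[(- _) r]/(- ((u r - u 0) / r)) /=; ring.
Qed.

(** Completing the slope by its limit m makes it usable when u takes the value
    u 0 arbitrarily close to 0. *)
Lemma slope_cvg A B u (chi : R -> R) m :
  u r @[r --> within A 0^'] --> u 0 ->
  (exists2 d : R, 0 < d & forall r, `|r| < d -> A r -> B (u r)) ->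
  dq [set s | B (u 0 + s)] (fun s => chi (u 0 + s)) m ->
  (if u r == u 0 then m else (chi (u r) - chi (u 0)) / (u r - u 0))
    @[r --> within A 0^'] --> m.
Proof.
move=> cu [d d0 AB] /dqP K.
have F : Filter (within A (0 : R)^') by exact: within_filter.
apply/cvgrPdist_lt => e e0; have [d' d'0 L] := K e e0.
have /cvgrPdist_lt/(_ d' d'0) := cu.
have : \forall r \near within A 0^', `|r| < d /\ A r.
  rewrite near_withinE near_withinE; apply/near_lineP.
  by exists d => // r; rewrite subr0.
apply: filterS2 => r [rd Ar] rd' /=; case: eqP => [_|/eqP ur].
  by rewrite subrr normr0.
rewrite distrC; have := L (u r - u 0).
rewrite /= addr0 addrC subrK; apply; first exact: AB.
  by rewrite subr_eq0.
by rewrite distrC.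
Qed.

(** Chain rule for an outer function that is only known on a set B containing
    the values of the inner one, in particular one-sidedly at an end of B. *)
Lemma dq_comp A B u (chi : R -> R) l m :
  dq A u l -> (exists2 d : R, 0 < d & forall r, `|r| < d -> A r -> B (u r)) ->
  dq [set s | B (u 0 + s)] (fun s => chi (u 0 + s)) m ->
  dq A (fun r => chi (u r)) (m * l).
Proof.
move=> H AB K; have F : Filter (within A (0 : R)^') by exact: within_filter.
apply: cvg_near_eq (cvgM (slope_cvg (dq_cont H) AB K) H); apply: nearW => r /=.
case: eqP => [->|/eqP ur]; first by rewrite !subrr !mul0r mulr0.
by rewrite mulrA divfK // subr_eq0.
Qed.

(** Only the continuity of u is assumed: its increments are those of v divided by
    slopes of chi, which tend to m. *)
Lemma dq_implicit A B u v (chi : R -> R) l m : m != 0 ->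
  u r @[r --> within A 0^'] --> u 0 ->
  (exists2 d : R, 0 < d & forall r, `|r| < d -> A r -> B (u r) /\ chi (u r) = v r) ->
  chi (u 0) = v 0 ->
  dq [set s | B (u 0 + s)] (fun s => chi (u 0 + s)) m ->
  dq A v l -> dq A u (l / m).
Proof.
move=> m0 cu [d d0 AB] uv0 K H.
have F : Filter (within A (0 : R)^') by exact: within_filter.
have AB' : exists2 d : R, 0 < d & forall r, `|r| < d -> A r -> B (u r).
  by exists d => // r rd /(AB r rd)[].
have Q := slope_cvg cu AB' K; apply: cvg_near_eq (cvgM H (cvgV m0 Q)).
have : \forall r \near within A 0^', `|r| < d /\ A r.
  rewrite near_withinE near_withinE; apply/near_lineP.
  by exists d => // r; rewrite subr0.
have m1 : 0 < `|m| by rewrite normr_gt0.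
have /cvgrPdist_lt/(_ _ m1) := Q.
apply: filterS2 => r mQ [rd Ar] /=; have [_ uvr] := AB r rd Ar.
move: mQ; rewrite -uvr -uv0; case: eqP => [-> _|/eqP ur mQ].
  by rewrite !subrr !mul0r.
have cu0 : chi (u r) - chi (u 0) != 0.
  by apply: contraTneq mQ => ->; rewrite mul0r subr0 ltxx.
by rewrite invf_div mulrC mulrA divfK.
Qed.

End DifferenceQuotients.

(** * Functions of class C^n on relatively open sets *)

Section Regularity.
Variable R : realType.
Implicit Types (p q : R * R) (S : set (R * R)) (f g : R * R -> R) (b : bool).
Implicit Types (Q : (R * R -> R) -> Prop).

(** Translation along the first axis for b = false, the second for b = true;
    the direction is a parameter so that each rule is proved once. *)
Definition shift b p (r : R) : R * R :=
  if b then (p.1, p.2 + r) else (p.1 + r, p.2).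

Definition has_partial b S f p (l : R) : Prop :=
  dq [set r | S (shift b p r)] (fun r => f (shift b p r)) l.

Lemma shift0 b p : shift b p 0 = p.
Proof. by case: b p => -[x h] /=; rewrite /shift /= addr0. Qed.

Lemma shiftD b p r s : shift b (shift b p r) s = shift b p (r + s).
Proof. by case: b p => -[x h] /=; rewrite /shift /= addrA. Qed.

Lemma shiftC b p r s :
  shift b (shift (~~ b) p r) s = shift (~~ b) (shift b p s) r.
Proof. by case: b p => -[x h] /=. Qed.

Lemma shift_near b p r e : 0 < e -> `|r| < e ->
  `|(shift b p r).1 - p.1| < e /\ `|(shift b p r).2 - p.2| < e.
Proof.
move=> e0 re; case: b; rewrite /shift /= subrr normr0; split => //.
  by rewrite addrAC subrr add0r.
by rewrite addrAC subrr add0r.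
Qed.

Lemma has_partial1E S f p l : has_partial1 S f p l <-> has_partial false S f p l.
Proof. by rewrite /has_partial /dq shift0. Qed.

Lemma has_partial2E S f p l : has_partial2 S f p l <-> has_partial true S f p l.
Proof. by rewrite /has_partial /dq shift0. Qed.

Lemma has_partial_local b S S' f g p l : f p = g p ->
  (exists2 d : R, 0 < d &
    forall q, `|q.1 - p.1| < d -> `|q.2 - p.2| < d -> S' q -> S q /\ f q = g q) ->
  has_partial b S f p l -> has_partial b S' g p l.
Proof.
move=> fg [d d0 H]; apply: dq_local; first by rewrite shift0.
exists d => // r rd Sr; have [h1 h2] := shift_near b p d0 rd.
exact: H.
Qed.

Lemma has_partial_unique b S f p l m : hopen S -> S p ->
  has_partial b S f p l -> has_partial b S f p m -> l = m.
Proof.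
move=> oS Sp; apply: dq_unique.
have [p0 [e e0 H]] := hopenP oS Sp; exists e => // r /andP[r0 re].
have [|h1 h2] := @shift_near b p r e e0; first by rewrite gtr0_norm.
by apply: H => //; case: (b); rewrite /shift /= ?addr_ge0 // ltW.
Qed.

Lemma has_partial_cst b S p c : has_partial b S (fun _ => c) p 0.
Proof. exact: dq_cst. Qed.

Lemma has_partial_fst b S p : has_partial b S fst p (~~ b)%:R.
Proof. by case: b; [exact: dq_cst | exact: dq_shift]. Qed.

Lemma has_partial_snd b S p : has_partial b S snd p b%:R.
Proof. by case: b; [exact: dq_shift | exact: dq_cst]. Qed.

Lemma has_partialD b S f g p l m :
  has_partial b S f p l -> has_partial b S g p m ->
  has_partial b S (fun q => f q + g q) p (l + m).
Proof. exact: dqD. Qed.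

Lemma has_partialM b S f g p l m :
  has_partial b S f p l -> has_partial b S g p m ->
  has_partial b S (fun q => f q * g q) p (l * g p + f p * m).
Proof.
move=> H1 H2; have := dqM H1 H2.
by rewrite !shift0.
Qed.

Lemma has_partialV b S f p l : f p != 0 ->
  has_partial b S f p l ->
  has_partial b S (fun q => (f q)^-1) p (- l * ((f p)^-1 * (f p)^-1)).
Proof.
move=> f0 H; have := dqV _ H.
by rewrite !shift0; apply.
Qed.

(** Class C^n on S, all the derivatives involved having in addition the
    property Q, typically a bound near the boundary. *)
Fixpoint Cn Q S (n : nat) f : Prop :=
  [/\ Q f, {within S, continuous f} &
    if n is m.+1 then
      exists D : bool -> R * R -> R, forall b,
        (forall p, S p -> has_partial b S f p (D b p)) /\ Cn Q S m (D b)
    else True].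

Definition no_bound f := True.

Lemma Cn_bound Q S n f : Cn Q S n f -> Q f.
Proof. by case: n => [|n] []. Qed.

Lemma Cn_cont Q S n f : Cn Q S n f -> {within S, continuous f}.
Proof. by case: n => [|n] []. Qed.

Lemma CnS Q S n f : Cn Q S n.+1 f -> Cn Q S n f.
Proof.
elim: n f => [|n IH] f [Qf cf [D HD]]; first by split.
split=> //; exists D => b; have [h1 h2] := HD b; split=> //.
exact: IH.
Qed.

Lemma within_cont_sub S S' f g : S' `<=` S -> (forall p, S' p -> f p = g p) ->
  {within S, continuous f} -> {within S', continuous g}.
Proof.
move=> SS fg /continuous_withinP H; apply/continuous_withinP => p Sp e e0.
have [d d0 K] := H p (SS _ Sp) e e0; exists d => // q Sq h1 h2.
by rewrite -!fg //; apply: K => //; exact: SS.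
Qed.

Lemma smooth_on_cont S f : smooth_on S f -> {within S, continuous f}.
Proof.
move=> [D [D0 HD]]; have [cD _ _] := HD 0%N 0%N.
by apply: within_cont_sub cD.
Qed.

Lemma Cn_sub Q Q' S S' n f g : S' `<=` S -> (forall p, S' p -> f p = g p) ->
  Q' g -> (forall u, Q u -> Q' u) -> Cn Q S n f -> Cn Q' S' n g.
Proof.
move=> SS fg Qg QQ; elim: n f g fg Qg => [|n IH] f g fg Qg [Qf cf H]; split => //.
- exact: within_cont_sub cf.
- exact: within_cont_sub cf.
case: H => D HD; exists D => b; have [h1 h2] := HD b; split.
  move=> p Sp; apply: has_partial_local (h1 p (SS _ Sp)); first exact: fg.
  by exists 1 => // q _ _ Sq; split; [exact: SS | exact: fg].
by apply: (IH (D b)) => //; apply/QQ/(Cn_bound h2).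
Qed.

Lemma Cn_eq Q S n f g : (forall p, S p -> f p = g p) -> Q g ->
  Cn Q S n f -> Cn Q S n g.
Proof. by move=> fg Qg; apply: Cn_sub. Qed.

Lemma within_contD S f g : {within S, continuous f} ->
  {within S, continuous g} -> {within S, continuous (fun p => f p + g p)}.
Proof.
move=> /subspace_continuousP cf /subspace_continuousP cg.
by apply/subspace_continuousP => p Sp; apply: cvgD; [exact: cf|exact: cg].
Qed.

Lemma within_contM S f g : {within S, continuous f} ->
  {within S, continuous g} -> {within S, continuous (fun p => f p * g p)}.
Proof.
move=> /subspace_continuousP cf /subspace_continuousP cg.
by apply/subspace_continuousP => p Sp; apply: cvgM; [exact: cf|exact: cg].
Qed.

Lemma CnD Q S n f g :
  (forall u v, Q u -> Q v -> Q (fun p => u p + v p)) ->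
  Cn Q S n f -> Cn Q S n g -> Cn Q S n (fun p => f p + g p).
Proof.
move=> QD; elim: n f g => [|n IH] f g Cf Cg; split.
- by apply: QD; [exact: Cn_bound Cf|exact: Cn_bound Cg].
- by apply: within_contD; [exact: Cn_cont Cf|exact: Cn_cont Cg].
- by [].
- by apply: QD; [exact: Cn_bound Cf|exact: Cn_bound Cg].
- by apply: within_contD; [exact: Cn_cont Cf|exact: Cn_cont Cg].
case: Cf => _ _ [D HD]; case: Cg => _ _ [E HE].
exists (fun b p => D b p + E b p) => b.
have [h1 h2] := HD b; have [k1 k2] := HE b; split; last exact: IH.
by move=> p Sp; apply: has_partialD; auto.
Qed.

Lemma CnM Q1 Q2 Q3 S n f g :
  (forall u v, Q1 u -> Q2 v -> Q3 (fun p => u p * v p)) ->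
  (forall u v, Q3 u -> Q3 v -> Q3 (fun p => u p + v p)) ->
  Cn Q1 S n f -> Cn Q2 S n g -> Cn Q3 S n (fun p => f p * g p).
Proof.
move=> QM QD; elim: n f g => [|n IH] f g Cf Cg; split.
- by apply: QM; [exact: Cn_bound Cf|exact: Cn_bound Cg].
- by apply: within_contM; [exact: Cn_cont Cf|exact: Cn_cont Cg].
- by [].
- by apply: QM; [exact: Cn_bound Cf|exact: Cn_bound Cg].
- by apply: within_contM; [exact: Cn_cont Cf|exact: Cn_cont Cg].
have Cf' := CnS Cf; have Cg' := CnS Cg.
case: Cf => _ _ [D HD]; case: Cg => _ _ [E HE].
exists (fun b p => D b p * g p + f p * E b p) => b.
have [h1 h2] := HD b; have [k1 k2] := HE b; split; last by apply: CnD => //; exact: IH.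
by move=> p Sp; apply: has_partialM; auto.
Qed.

Lemma Cn_cst Q S n (c : R) : (forall c', Q (fun _ => c')) ->
  Cn Q S n (fun _ => c).
Proof.
move=> Qc; elim: n c => [|n IH] c; split => //; try by move=> x; exact: cvg_cst.
by exists (fun _ _ => 0) => b; split => // p _; exact: has_partial_cst.
Qed.

Lemma Cn_fst Q S n : Q fst -> (forall c', Q (fun _ => c')) -> Cn Q S n fst.
Proof.
move=> Q1 Qc; have C : {within S, continuous (fst : R * R -> R)}.
  by apply/continuous_withinP => p Sp e e0; exists e.
case: n => [|n]; split => //.
exists (fun b _ => (~~ b)%:R) => b; split; last exact: Cn_cst.
by move=> p _; exact: has_partial_fst.
Qed.

Lemma Cn_snd Q S n : Q snd -> (forall c', Q (fun _ => c')) -> Cn Q S n snd.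
Proof.
move=> Q1 Qc; have C : {within S, continuous (snd : R * R -> R)}.
  by apply/continuous_withinP => p Sp e e0; exists e.
case: n => [|n]; split => //.
exists (fun b _ => b%:R) => b; split; last exact: Cn_cst.
by move=> p _; exact: has_partial_snd.
Qed.

Lemma CnV S n f : (forall p, S p -> f p != 0) ->
  Cn no_bound S n f -> Cn no_bound S n (fun p => (f p)^-1).
Proof.
move=> f0; elim: n => [|n IH] Cf; split => //.
- apply/subspace_continuousP => p Sp; apply: cvgV; first exact: f0.
  by move: p Sp; apply/subspace_continuousP; exact: Cn_cont Cf.
- apply/subspace_continuousP => p Sp; apply: cvgV; first exact: f0.
  by move: p Sp; apply/subspace_continuousP; exact: Cn_cont Cf.
have CV := IH (CnS Cf).
case: Cf => _ _ [D HD].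
exists (fun b p => - D b p * ((f p)^-1 * (f p)^-1)) => b.
have [h1 h2] := HD b; split.
  by move=> p Sp; apply: has_partialV; auto.
apply: (@CnM no_bound no_bound) => //; last exact: (@CnM no_bound no_bound).
apply: (@Cn_eq _ _ _ (fun p => -1 * D b p)) => // [p _|].
  by rewrite mulN1r.
by apply: (@CnM no_bound no_bound) => //; exact: Cn_cst.
Qed.

(** * The mean value theorem and the symmetry of second derivatives *)

Lemma dq_MVT (u du : R -> R) s : 0 < s ->
  (forall t, 0 <= t <= s ->
    dq [set r | 0 <= t + r <= s] (fun r => u (t + r)) (du t)) ->
  exists2 t, 0 < t < s & u s - u 0 = du t * s.
Proof.
move=> s0 H; have [||t] := @MVT R u du 0 s s0.
- move=> t; rewrite in_itv /= => /andP[t0 ts].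
  have K : h^-1 *: (u (h *: (1 : R) + t) - u t) @[h --> (0 : R)^'] --> du t.
    apply/cvgrPdist_lt => e e0.
    have /dqP/(_ e e0)[d d0 L] : dq [set r | 0 <= t + r <= s]
      (fun r => u (t + r)) (du t) by apply: H; rewrite !ltW.
    rewrite near_withinE; apply/near_lineP.
    exists (Num.min d (Num.min t (s - t))).
      by rewrite !lt_min d0 t0 subr_gt0.
    move=> r; rewrite subr0 !lt_min => /and3P[rd rt rs] r0.
    have := L r; rewrite /= => {}L; rewrite distrC; move: L.
    rewrite [X in X * _ - _](_ : _ = u (t + r) - u t); last by rewrite addr0.
    rewrite -[r%:A]/(r * 1) mulr1 -[_ *: _]/(_ * _) mulrC (addrC r t); apply => //.
    by move: rt rs; rewrite !ltr_norml => /andP[? ?] /andP[? ?]; lra.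
  by split; [apply: cvgP K | apply: cvg_lim K].
- apply/subspace_continuousP => t; rewrite /= in_itv /= => ts.
  have := dq_cont (H t ts); rewrite addr0 => /cvgrPdist_lt K.
  apply/cvgrPdist_lt => e e0; have := K e e0; rewrite !near_withinE.
  move=> /near_lineP[d d0 L]; apply/near_lineP; exists d => // x xd xs.
  have [->|xt] := eqVneq x t; first by rewrite subrr normr0.
  have := L (x - t); rewrite subr0 (addrC t) subrK; apply => //.
    by rewrite subr_eq0.
  by rewrite /= (addrC t) subrK; move: xs; rewrite /= in_itv.
by rewrite in_itv /= => ts; rewrite subr0; exists t.
Qed.

Lemma has_partial_segment b S f p s t l :
  (forall t, 0 <= t <= s -> S (shift b p t)) ->
  has_partial b S f (shift b p t) l ->
  dq [set r | 0 <= t + r <= s] (fun r => f (shift b p (t + r))) l.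
Proof.
move=> HS; apply: dq_local; first by rewrite shift0 addr0.
by exists 1 => // r _ rs; rewrite /= shiftD; split => //; exact: HS.
Qed.

Lemma has_partial_MVT b S f df p s : 0 < s ->
  (forall t, 0 <= t <= s -> S (shift b p t)) ->
  (forall q, S q -> has_partial b S f q (df q)) ->
  exists2 t, 0 < t < s & f (shift b p s) - f p = df (shift b p t) * s.
Proof.
move=> s0 HS Hf.
have [t ts H] := dq_MVT (u := fun t => f (shift b p t))
  (du := fun t => df (shift b p t)) s0
  (fun t ts => has_partial_segment HS (Hf _ (HS t ts))).
by exists t => //; rewrite -H shift0.
Qed.

(** The mean value theorem is applied to the difference of two parallel sections,
    then to its derivative. *)
Lemma second_difference b S f df ddf p s : 0 < s ->
  (forall t t', 0 <= t <= s -> 0 <= t' <= s ->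
    S (shift b (shift (~~ b) p t') t)) ->
  (forall q, S q -> has_partial b S f q (df q)) ->
  (forall q, S q -> has_partial (~~ b) S df q (ddf q)) ->
  exists t t', [/\ 0 < t < s, 0 < t' < s &
    f (shift b (shift (~~ b) p s) s) - f (shift (~~ b) p s)
      - f (shift b p s) + f p = ddf (shift b (shift (~~ b) p t') t) * s * s].
Proof.
move=> s0 HS Hf Hdf; have s00 : 0 <= s <= s by rewrite lexx ltW.
have z0 : 0 <= (0 : R) <= s by rewrite lexx ltW.
have HS0 t : 0 <= t <= s -> S (shift b p t).
  by move=> ts; have := HS t 0 ts z0; rewrite shift0.
have [t ts Ht] := dq_MVT
  (u := fun t => f (shift b (shift (~~ b) p s) t) + -1 * f (shift b p t))
  (du := fun t => df (shift b (shift (~~ b) p s) t) +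
     (0 * f (shift b p (t + 0)) + -1 * df (shift b p t))) s0
  (fun t ts => dqD (has_partial_segment (fun t ts => HS t s ts s00)
    (Hf _ (HS t s ts s00)))
    (dqM (@dq_cst _ _ _) (has_partial_segment HS0 (Hf _ (HS0 t ts))))).
have ts' : 0 <= t <= s by case/andP: ts => *; rewrite !ltW.
have [|t' t's Ht'] := has_partial_MVT (b := ~~ b) (p := shift b p t) s0 _ Hdf.
  by move=> t' t's; rewrite -shiftC; exact: HS.
exists t, t'; split => //; rewrite [in RHS]shiftC -Ht' -[in RHS]shiftC.
move: Ht; rewrite !shift0 => Ht.
transitivity (f (shift b (shift (~~ b) p s) s) + -1 * f (shift b p s) -
  (f (shift (~~ b) p s) + -1 * f p)); first by ring.
by rewrite Ht; ring.
Qed.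

Lemma shift_box d s b p t t' : 0 <= p.2 -> s < d -> 0 <= t <= s ->
  0 <= t' <= s ->
  [/\ `|(shift b (shift (~~ b) p t') t).1 - p.1| < d,
     `|(shift b (shift (~~ b) p t') t).2 - p.2| < d &
     0 <= (shift b (shift (~~ b) p t') t).2].
Proof.
move=> p0 sd /andP[t0 ts] /andP[t'0 t's].
have [td t'd] : t < d /\ t' < d by split; exact: le_lt_trans sd.
have E (x y : R) : x + y - x = y by ring.
by case: b; rewrite /shift /= !E !ger0_norm // addr_ge0.
Qed.

(** Only increments with positive components are compared, so the argument also
    covers the points of the boundary line. *)
Lemma partials_commute S f g f' g' p : hopen S -> S p ->
  {within S, continuous f'} -> {within S, continuous g'} ->
  (forall q, S q -> has_partial false S f q (f' q)) -> 
  (forall q, S q -> has_partial true S g q (g' q)) -> 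
  (forall u, (forall q, S q -> has_partial true S u q (f q)) ->
    (forall q, S q -> has_partial false S u q (g q)) -> f' p = g' p).
Proof.
move=> oS Sp /continuous_withinP cf /continuous_withinP cg Hf Hg u Hu1 Hu2.
have [p0 [e e0 He]] := hopenP oS Sp.
apply/eqP; rewrite -subr_eq0 -normr_le0; apply/ler_addgt0Pl => eta eta0.
have eta2 : 0 < eta / 2 by lra.
have [d1 d10 H1] := cf p Sp _ eta2; have [d2 d20 H2] := cg p Sp _ eta2.
pose s := Num.min e (Num.min d1 d2) / 2.
have [s0 [se sd1 sd2]] : 0 < s /\ [/\ s < e, s < d1 & s < d2].
  have : 0 < Num.min e (Num.min d1 d2) by rewrite !lt_min e0 d10.
  have : Num.min e (Num.min d1 d2) <= e by rewrite !ge_min lexx.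
  have : Num.min e (Num.min d1 d2) <= d1 by rewrite !ge_min lexx orbT.
  have : Num.min e (Num.min d1 d2) <= d2 by rewrite !ge_min lexx !orbT.
  by rewrite /s; split; [|split]; lra.
have HS b t t' : 0 <= t <= s -> 0 <= t' <= s -> S (shift b (shift (~~ b) p t') t).
  by move=> ts ts'; have [*] := shift_box b p0 se ts ts'; exact: He.
have [t1 [t1' [ts1 ts1' E1]]] := second_difference s0 (HS true) Hu1 Hf.
have [t2 [t2' [ts2 ts2' E2]]] := second_difference s0 (HS false) Hu2 Hg.
have W t : 0 < t < s -> 0 <= t <= s by case/andP=> *; rewrite !ltW.
have [a1 a2 a3] := shift_box true p0 sd1 (W _ ts1) (W _ ts1').
have [b1 b2 b3] := shift_box false p0 sd2 (W _ ts2) (W _ ts2').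
have := H1 _ (HS _ _ _ (W _ ts1) (W _ ts1')) a1 a2.
have := H2 _ (HS _ _ _ (W _ ts2) (W _ ts2')) b1 b2.
have E : f' (shift true (shift (~~ true) p t1') t1) =
    g' (shift false (shift (~~ false) p t2') t2).
  have ss : s * s != 0 by rewrite mulf_neq0 // gt_eqF.
  by apply: (mulIf ss); rewrite [LHS]mulrA [RHS]mulrA -E1 -E2 /shift /=; ring.
rewrite E !ltr_norml addr0 ler_norml => /andP[? ?] /andP[? ?].
by apply/andP; split; lra.
Qed.

Definition Cinfty Q S f := forall n, Cn Q S n f.

Lemma Cinfty_partial Q S f b : hopen S ->
  (forall u v, (forall p, S p -> u p = v p) -> Q u -> Q v) ->
  Cinfty Q S f -> exists g,
    (forall p, S p -> has_partial b S f p (g p)) /\ Cinfty Q S g.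
Proof.
move=> oS QE Cf; have [_ _ [D HD]] := Cf 1%N.
have [h1 h2] := HD b; exists (D b); split => // n.
have [_ _ [E HE]] := Cf n.+1.
have [k1 k2] := HE b; apply: Cn_eq k2; last by case: h2.
by move=> p Sp; apply: (has_partial_unique oS Sp (k1 p Sp) (h1 p Sp)).
Qed.

(** A function of class C^n for every n has a coherent family of partial
    derivatives: this is where the order of differentiation must not matter. *)
Lemma Cinfty_smooth Q S f : hopen S ->
  (forall u v, (forall p, S p -> u p = v p) -> Q u -> Q v) ->
  Cinfty Q S f ->
  exists2 D, partial_derivatives S f D & forall i j, Q (D i j).
Proof.
move=> oS QE Cf.
have /choice[d Hd] : forall bu : bool * (R * R -> R), exists g,
    Cinfty Q S bu.2 -> (forall p, S p -> has_partial bu.1 S bu.2 p (g p)) /\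
      Cinfty Q S g.
  move=> [b u]; have [Cu|nCu] := pselect (Cinfty Q S u).
    by have [g Hg] := Cinfty_partial b oS QE Cu; exists g.
  by exists u.
pose d1 u := d (false, u); pose d2 u := d (true, u).
have H1 u : Cinfty Q S u -> (forall p, S p -> has_partial false S u p (d1 u p)) /\
  Cinfty Q S (d1 u) by move=> Cu; exact: (Hd (false, u)).
have H2 u : Cinfty Q S u -> (forall p, S p -> has_partial true S u p (d2 u p)) /\
  Cinfty Q S (d2 u) by move=> Cu; exact: (Hd (true, u)).
have C1 i u : Cinfty Q S u -> Cinfty Q S (iter i d1 u).
  by move=> Cu; elim: i => //= i IH; apply: (H1 _ IH).2.
have C2 i u : Cinfty Q S u -> Cinfty Q S (iter i d2 u).
  by move=> Cu; elim: i => //= i IH; apply: (H2 _ IH).2.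
have d1_eq u v : Cinfty Q S u -> Cinfty Q S v -> (forall p, S p -> u p = v p) ->
    forall p, S p -> d1 u p = d1 v p.
  move=> Cu Cv uv p Sp; apply: (has_partial_unique oS Sp) ((H1 v Cv).1 p Sp).
  apply: has_partial_local ((H1 u Cu).1 p Sp); first exact: uv.
  by exists 1 => // q _ _ Sq; split => //; exact: uv.
have comm i u : Cinfty Q S u ->
    forall p, S p -> d2 (iter i d1 u) p = iter i d1 (d2 u) p.
  move=> Cu; elim: i => //= i IH p Sp; have Ci := C1 i u Cu.
  rewrite -(d1_eq _ _ _ _ IH) //; last exact/C1/(H2 _ Cu).2; last exact: (H2 _ Ci).2.
  have [k1 k2] := H1 _ Ci; have [l1 l2] := H2 _ Ci.
  have [m1 m2] := H2 _ k2; have [n1 n2] := H1 _ l2.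
  apply/esym; apply: (partials_commute oS Sp _ _ n1 m1 l1 k1).
    exact: Cn_cont (n2 0%N).
  exact: Cn_cont (m2 0%N).
exists (fun i j => iter i d1 (iter j d2 f)); last first.
  by move=> i j; apply: Cn_bound (C1 _ _ (C2 _ _ Cf) 0%N).
split=> // i j; have Cj := C2 j f Cf; have Cij := C1 i _ Cj; split.
- exact: Cn_cont (Cij 0%N).
- by move=> p Sp; apply/has_partial1E/(H1 _ Cij).1.
- move=> p Sp; apply/has_partial2E.
  by rewrite -[iter j.+1 d2 f]/(d2 (iter j d2 f)) -comm //; exact: (H2 _ Cij).1.
Qed.

Lemma smooth_Cinfty Q S f D : partial_derivatives S f D ->
  (forall i j, Q (D i j)) -> Q f -> Cinfty Q S f.
Proof.
move=> [D0 HD] QD Qf n; apply: Cn_eq D0 Qf _.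
suff H i j : Cn Q S n (D i j) by [].
elim: n i j => [|n IH] i j; have [h1 h2 h3] := HD i j; split=> //.
exists (fun b => if b then D i j.+1 else D i.+1 j) => -[]; split => // p Sp.
  exact/has_partial2E/h3.
exact/has_partial1E/h2.
Qed.

End Regularity.

(** * Moderate and negligible functions near the boundary *)

Section FlatCalculus.
Variable R : realType.
Implicit Types (p q : R * R) (S W : set (R * R)) (f g u v : R * R -> R).
Implicit Types (a : R -> R).

(** Negligible (resp. moderate) functions decay faster (resp. grow slower) than
    some power of h, on the region where t itself is at most a power of 1 / h.
    Allowing t to grow makes both notions stable under multiplication by t and
    under the changes of variables t = tau / sqrt h and t = tau / h, which blow
    up at h = 0. *)
Definition flat W f := forall N : nat, exists2 d : R, 0 < d &
  forall p, W p -> 0 < p.2 < d -> `|p.1| * p.2 ^+ N <= 1 -> `|f p| <= p.2 ^+ N.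

Definition moderate W f := forall N : nat, exists M : nat, exists2 d : R, 0 < d &
  forall p, W p -> 0 < p.2 < d -> `|p.1| * p.2 ^+ N <= 1 ->
    `|f p| * p.2 ^+ M <= 1.

(** The growth allowed for t and the decay obtained are independent of each other,
    although a single exponent bounds both in the definition. *)
Lemma flat_weaken W f N K : flat W f -> exists2 d : R, 0 < d &
  forall p, W p -> 0 < p.2 < d -> `|p.1| * p.2 ^+ N <= 1 -> `|f p| <= p.2 ^+ K.
Proof.
move=> /(_ (N + K)%N)[d d0 H]; exists (Num.min d 1); first by rewrite lt_min d0 /=.
move=> p Wp /andP[h0]; rewrite lt_min => /andP[hd h1] pN.
have hn (n : nat) : p.2 ^+ n <= 1 by apply: exprn_ile1; rewrite ltW.
have hn0 (n : nat) : 0 <= p.2 ^+ n by rewrite exprn_ge0 // ltW.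
apply: le_trans (H p Wp _ _) _; first by rewrite h0.
  rewrite exprD mulrA; apply: le_trans pN; rewrite ler_piMr //.
  by rewrite mulr_ge0.
by rewrite exprD ler_piMl.
Qed.

Lemma flatD W f g : flat W f -> flat W g -> flat W (fun p => f p + g p).
Proof.
move=> Hf Hg N; have [d d0 K] := flat_weaken N N.+1 Hf.
have [d' d'0 K'] := flat_weaken N N.+1 Hg.
exists (Num.min (Num.min d d') (2^-1)); first by rewrite !lt_min d0 d'0 invr_gt0 ltr0n.
move=> p Wp /andP[h0]; rewrite !lt_min => /andP[/andP[hd hd'] h1] pN.
apply: le_trans (ler_normD _ _) _.
have := lerD (K p Wp _ pN) (K' p Wp _ pN); rewrite h0 hd hd' => /(_ erefl erefl).
move=> L; apply: le_trans L _; rewrite exprS -mulrDl ler_piMl //.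
  by rewrite exprn_ge0 // ltW.
lra.
Qed.

Lemma moderateD W f g : moderate W f -> moderate W g ->
  moderate W (fun p => f p + g p).
Proof.
move=> Hf Hg N; have [M [d d0 K]] := Hf N; have [M' [d' d'0 K']] := Hg N.
exists (M + M').+1; exists (Num.min (Num.min d d') (2^-1)).
  by rewrite !lt_min d0 d'0 invr_gt0 ltr0n.
move=> p Wp /andP[h0]; rewrite !lt_min => /andP[/andP[hd hd'] h1] pN.
have hn (n : nat) : 0 <= p.2 ^+ n <= 1.
  by rewrite exprn_ge0 ?exprn_ile1 ?ltW //=; lra.
have {K} : `|f p| * p.2 ^+ M <= 1 by apply: K; rewrite ?h0.
have {K'} : `|g p| * p.2 ^+ M' <= 1 by apply: K'; rewrite ?h0.
rewrite exprSr exprD; move: (hn M) (hn M').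
have := ler_normD (f p) (g p); have := normr_ge0 (f p); have := normr_ge0 (g p).
move: `|f p + g p| `|f p| `|g p| (p.2 ^+ M) (p.2 ^+ M') => z x y X Y.
move=> y0 x0 zxy /andP[X0 X1] /andP[Y0 Y1] yY xX.
have A : x * (X * Y) <= 1 by rewrite mulrA mulr_ile1 // mulr_ge0.
have B : y * (X * Y) <= 1 by rewrite (mulrC X) mulrA mulr_ile1 // mulr_ge0.
have XY0 : 0 <= X * Y by rewrite mulr_ge0.
have : z * (X * Y) <= 2 by apply: le_trans (ler_wpM2r XY0 zxy) _; rewrite mulrDl; lra.
move=> C; rewrite mulrA; apply: le_trans (ler_wpM2r (ltW h0) C) _; lra.
Qed.

Lemma moderateM W f g : moderate W f -> moderate W g ->
  moderate W (fun p => f p * g p).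
Proof.
move=> Hf Hg N; have [M [d d0 K]] := Hf N; have [M' [d' d'0 K']] := Hg N.
exists (M + M')%N; exists (Num.min d d'); first by rewrite !lt_min d0.
move=> p Wp /andP[h0]; rewrite !lt_min => /andP[hd hd'] pN.
rewrite normrM exprD mulrACA; apply: mulr_ile1.
- by rewrite mulr_ge0 // exprn_ge0 // ltW.
- by rewrite mulr_ge0 // exprn_ge0 // ltW.
- by apply: K; rewrite ?h0.
- by apply: K'; rewrite ?h0.
Qed.

Lemma moderateM_flat W f g : moderate W f -> flat W g ->
  flat W (fun p => f p * g p).
Proof.
move=> Hf Hg N; have [M [d d0 K]] := Hf N.
have [d' d'0 K'] := flat_weaken N (M + N) Hg.
exists (Num.min d d'); first by rewrite !lt_min d0.
move=> p Wp /andP[h0]; rewrite !lt_min => /andP[hd hd'] pN.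
rewrite normrM; have fp : `|f p| * p.2 ^+ M <= 1 by apply: K; rewrite ?h0.
have gp : `|g p| <= p.2 ^+ (M + N) by apply: K'; rewrite ?h0.
apply: le_trans (ler_wpM2l (normr_ge0 _) gp) _.
by rewrite exprD mulrA ler_piMl // exprn_ge0 // ltW.
Qed.

Lemma moderate_cst W (c : R) : moderate W (fun _ => c).
Proof.
move=> N; exists 1%N; have c1 : 0 < `|c| + 1 by have := normr_ge0 c; lra.
exists (`|c| + 1)^-1; first by rewrite invr_gt0.
move=> p _ /andP[h0 hd] _; rewrite expr1.
have : (`|c| + 1) * p.2 <= 1 by rewrite -ler_pdivlMl // mulr1 ltW.
by apply: le_trans; rewrite ler_wpM2r ?ltW // ltrDl.
Qed.

Lemma moderate_fst W : moderate W fst.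
Proof. by move=> N; exists N; exists 1. Qed.

Lemma moderate_inv W : moderate W (fun p => p.2^-1).
Proof.
move=> N; exists 1%N; exists 1 => // p _ /andP[h0 _] _.
by rewrite expr1 normrV ?unitfE ?gt_eqF // gtr0_norm // mulVf // gt_eqF.
Qed.

Lemma Cn_inv_height W n : W `<=` [set p | 0 < p.2] ->
  Cn (moderate W) W n (fun p => p.2^-1).
Proof.
move=> W0; have W0' p : W p -> p.2 != 0 by move=> /W0/= h; rewrite gt_eqF.
have cV : {within W, continuous (fun p : R * R => p.2^-1)}.
  apply: (@Cn_cont _ (@no_bound R) _ 0); apply: CnV => //.
  exact: Cn_snd.
elim: n => [|n IH]; split => //; try exact: moderate_inv.
exists (fun b p => - b%:R * (p.2^-1 * p.2^-1)) => b; split.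
  by move=> p Wp; apply: has_partialV; [exact: W0'|exact: has_partial_snd].
apply: CnM (@moderateM W) (@moderateD W) _ _; last exact: CnM (@moderateM W) (@moderateD W) _ _.
by apply: Cn_cst => c; exact: moderate_cst.
Qed.

(** The functions a of the height with a' = c a / h: up to constants, the powers
    h ^ c. Only those that grow at most like 1 / h at 0 are considered. *)
Definition power_scale a (c : R) := forall h, 0 < h ->
  [/\ 0 < a h, dq setT (fun r => a (h + r)) (c * (a h / h)) &
      h <= 1 -> a h * h <= 1].

Lemma Cn_power_scale a c W n : power_scale a c -> W `<=` [set p | 0 < p.2] ->
  Cn (moderate W) W n (fun p => a p.2).
Proof.
move=> Ha W0.
have ma : moderate W (fun p => a p.2).
  move=> N; exists 1%N; exists 1 => // p _ /andP[h0 h1] _.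
  by have [a0 _ ah] := Ha _ h0; rewrite expr1 gtr0_norm // ah // ltW.
have ca : {within W, continuous (fun p : R * R => a p.2)}.
  apply/continuous_withinP => p /W0/= p0 e e0; have [_ + _] := Ha _ p0.
  move=> /dq_cont /cvgrPdist_lt/(_ _ e0); rewrite addr0 !near_withinE.
  move=> /near_lineP[d d0 H]; exists d => // q _ _ h2.
  have [->|qp] := eqVneq q.2 p.2; first by rewrite subrr normr0.
  have := H (q.2 - p.2); rewrite (addrC p.2) subrK subr0 (distrC (a p.2)); apply => //.
  by rewrite subr_eq0.
elim: n => [|n IH]; split => //.
exists (fun b p => b%:R * c * (a p.2 * p.2^-1)) => b; split.
  move=> p Wp; case: b; last by rewrite !mul0r; exact: (@dq_cst _ _ (a p.2)).
  rewrite mul1r; have [_ + _] := Ha _ (W0 _ Wp); rewrite /has_partial.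
  by apply: dq_local; [|exists 1].
apply: CnM (@moderateM W) (@moderateD W) _ _.
  by apply: Cn_cst => c'; exact: moderate_cst.
by apply: CnM (@moderateM W) (@moderateD W) _ _ => //; exact: Cn_inv_height.
Qed.

(** The increment is split at (u 0, h + r). Its vertical part is a difference
    quotient at a fixed point; the horizontal part starts at a moving point, and
    needs the mean value theorem and the continuity of f1. *)
Lemma dq_chain2 W f f1 l1 l2 (u : R -> R) (h : R) :
  hopen W -> 0 < h -> W (u 0, h) ->
  (forall q, W q -> has_partial false W f q (f1 q)) ->
  {within W, continuous f1} ->
  has_partial true W f (u 0, h) l2 ->
  dq setT u l1 ->
  dq setT (fun r => f (u r, h + r)) (f1 (u 0, h) * l1 + l2).
Proof.
move=> oW h0 Wq Hf1 /continuous_withinP cf1 Hf2 Hu.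
have [_ [d d0 HW]] := hopenP oW Wq.
have F : Filter (within setT (0 : R)^') by exact: within_filter.
pose Q r := if u r == u 0 then f1 (u 0, h) else
  (f (u r, h + r) - f (u 0, h + r)) / (u r - u 0).
have HQ : Q r @[r --> within setT 0^'] --> f1 (u 0, h).
  apply/cvgrPdist_lt => e e0; have [d' d'0 L] := cf1 _ Wq e e0.
  pose m := Num.min (Num.min d d') h.
  have m0 : 0 < m by rewrite !lt_min d0 d'0 h0.
  have /cvgrPdist_lt/(_ m m0) := dq_cont Hu.
  have : \forall r \near within setT (0 : R)^', `|r| < m.
    by rewrite !near_withinE; apply/near_lineP; exists m => // r; rewrite subr0.
  apply: filterS2 => r rm um; rewrite /Q; case: eqP => [_|/eqP ur].
    by rewrite subrr normr0.
  move: rm; rewrite !lt_min => /andP[/andP[rd rd'] rh].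
  move: um; rewrite !lt_min => /andP[/andP[ud ud'] uh].
  have hr0 : 0 <= h + r by move: rh; rewrite ltr_norml => /andP[]; lra.
  have near x : `|x - u 0| < d -> W (x, h + r).
    by move=> xd; apply: HW => //=; rewrite addrAC subrr add0r.
  have close x : `|x - u 0| < d -> `|x - u 0| < d' ->
      `|f1 (x, h + r) - f1 (u 0, h)| < e.
    move=> xd xd'; apply: L; [exact: near| |] => //=.
    by rewrite addrAC subrr add0r.
  rewrite distrC.
  have [ltu|leu] := ltP (u 0) (u r).
    have s0 : 0 < u r - u 0 by rewrite subr_gt0.
    move: ud ud'; rewrite ![`|u 0 - _|]distrC [`|u r - u 0|]gtr0_norm // => ud ud'.
    have [|t /andP[t0 ts]] := @has_partial_MVT _ false W f f1 (u 0, h + r) _ s0 _ Hf1.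
      move=> t /andP[t0 ts]; apply: near; rewrite addrAC subrr add0r ger0_norm //.
      exact: le_lt_trans ud.
    rewrite /shift /= [u 0 + _]addrC subrK => ->; rewrite mulfK ?gt_eqF //.
    by apply: close; rewrite addrAC subrr add0r gtr0_norm //; apply: lt_trans ts _.
  have s0 : 0 < u 0 - u r by rewrite subr_gt0 lt_neqAle ur.
  move: ud ud'; rewrite [`|u 0 - u r|]gtr0_norm // => ud ud'.
  have [|t /andP[t0 ts]] := @has_partial_MVT _ false W f f1 (u r, h + r) _ s0 _ Hf1.
    move=> t /andP[t0 ts]; apply: near; rewrite ltr_norml /=.
    by apply/andP; split; lra.
  rewrite /shift /= [u r + (_ - _)]addrC subrK => E.
  have -> : f (u r, h + r) - f (u 0, h + r) =
      f1 (u r + t, h + r) * (u r - u 0) by rewrite -opprB E; ring.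
  rewrite mulfK ?subr_eq0 //.
  by apply: close; rewrite ltr_norml /=; apply/andP; split; lra.
have Hf : dq setT (fun r => f (u 0, h + r)) l2.
  apply: dq_local Hf2; first by [].
  exists (Num.min d h); first by rewrite lt_min d0.
  move=> r; rewrite lt_min => /andP[rd rh] _; split => //.
  apply: HW => /=; rewrite ?subrr ?normr0 //.
    by rewrite addrAC subrr add0r.
  by move: rh; rewrite ltr_norml => /andP[]; lra.
apply: cvg_near_eq (cvgD (cvgM HQ Hu) Hf); apply: nearW => r /=.
rewrite addr0.
rewrite /Q; case: eqP => [->|/eqP ur]; first by rewrite subrr mul0r mulr0 add0r.
by rewrite mulrA divfK ?subr_eq0 // -mulrDl; congr (_ / _); ring.
Qed.

(** Functions with negligible derivatives are stable under rescaling of the first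
    variable by a power of h: the powers of h that differentiation produces are
    moderate. *)
Lemma Cn_rescale a c W W' n f : power_scale a c -> hopen W -> hopen W' ->
  W' `<=` [set p | 0 < p.2] -> (forall p, W' p -> W (p.1 * a p.2, p.2)) ->
  Cn (flat W) W n f -> Cn (flat W') W' n (fun p => f (p.1 * a p.2, p.2)).
Proof.
move=> Ha oW oW' W'0 WW'.
have cflat u : flat W u -> flat W' (fun p => u (p.1 * a p.2, p.2)).
  move=> Hu N; have [d d0 K] := flat_weaken N.+1 N Hu.
  exists (Num.min d 1); first by rewrite lt_min d0 /=.
  move=> p Wp /andP[h0]; rewrite lt_min => /andP[hd h1] pN.
  have [a0 _ /(_ (ltW h1)) ah] := Ha _ h0.
  apply: (K (p.1 * a p.2, p.2)); first exact: WW'.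
    by rewrite /= h0.
  rewrite /= normrM (gtr0_norm a0) exprSr mulrACA mulr_ile1 //.
    by rewrite mulr_ge0 // exprn_ge0 // ltW.
  by rewrite mulr_ge0 ?ltW.
have cont u : {within W, continuous u} ->
    {within W', continuous (fun p => u (p.1 * a p.2, p.2))}.
  have /continuous_withinP ca : {within W', continuous (fun p => p.1 * a p.2)}.
    apply: within_contM; last exact: Cn_cont (Cn_power_scale 0 Ha W'0).
    exact: Cn_cont (@Cn_fst _ (@no_bound R) W' 0 I (fun=> I)).
  move=> /continuous_withinP cu; apply/continuous_withinP => p W'p e e0.
  have [d d0 H] := cu _ (WW' _ W'p) e e0; have [d' d'0 H'] := ca _ W'p d d0.
  exists (Num.min d d'); first by rewrite lt_min d0.
  move=> q W'q; rewrite !lt_min => /andP[h1 h1'] /andP[h2 h2'].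
  by apply: H => //=; [exact: WW'|exact: H'].
elim: n f => [|n IH] f Cf; split => //; try by [apply/cflat/(Cn_bound Cf)|
  apply/cont/(Cn_cont Cf)].
case: Cf => _ _ [D HD]; have [h1 k1] := HD false; have [h2 k2] := HD true.
exists (fun b p => if b
  then c * (p.1 * (a p.2 * p.2^-1)) * D false (p.1 * a p.2, p.2)
       + D true (p.1 * a p.2, p.2)
  else a p.2 * D false (p.1 * a p.2, p.2)) => b.
have Ca := Cn_power_scale n Ha W'0; have Ch := Cn_inv_height n W'0.
have Cc : Cn (moderate W') W' n (fun _ => c).
  by apply: Cn_cst => c'; exact: moderate_cst.
have C1 : Cn (moderate W') W' n fst.
  by apply: Cn_fst => [|c']; [exact: moderate_fst|exact: moderate_cst].
have mM := CnM (@moderateM W') (@moderateD W').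
have fM := CnM (@moderateM_flat W') (@flatD W').
split; last first.
  case: b; last by apply: fM => //; exact: IH.
  apply: CnD (@flatD W') _ (IH _ k2); apply: fM (IH _ k1).
  by apply: (mM) Cc _; apply: (mM) C1 _; exact: (mM).
move=> p W'p; have h0 : 0 < p.2 := W'0 _ W'p; have [a0 da _] := Ha _ h0.
have Wp := WW' _ W'p; case: b; last first.
  rewrite mulrC; have [_ [d d0 HW']] := hopenP oW' W'p.
  apply: (@dq_comp _ _ [set x | W (x, p.2)] (fun r => (p.1 + r) * a p.2)
    (fun x => f (x, p.2))).
  - have := dqM (@dq_shift _ [set r | W' (shift false p r)] p.1)
      (@dq_cst _ _ (a p.2)).
    by rewrite mul1r mulr0 addr0.
  - by exists 1 => // r _ /WW'.
  - rewrite /= addr0; exact: (h1 _ Wp).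
have Hu : dq setT (fun r => p.1 * a (p.2 + r)) (c * (p.1 * (a p.2 * p.2^-1))).
  have := dqM (@dq_cst _ _ p.1) da.
  by rewrite mul0r add0r (_ : _ * (c * _) = c * (p.1 * (a p.2 / p.2))) //; ring.
have := @dq_chain2 W f (D false) _ (D true (p.1 * a p.2, p.2)) _ _ oW h0 _ h1
  (Cn_cont k1) _ Hu.
rewrite addr0 => /(_ Wp (h2 _ Wp)); rewrite mulrC.
by apply: dq_local; [|exists 1].
Qed.

Definition extend0 f p := if 0 < p.2 then f p else 0.

Lemma flat_near W f (x : R) : flat W f -> exists2 d : R, 0 < d &
  forall q, W q -> 0 < q.2 < d -> `|q.1 - x| < 1 -> `|f q| <= q.2 ^+ 2.
Proof.
move=> Hf; have [d d0 K] := flat_weaken 1 2 Hf.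
have x1 : 0 < `|x| + 1 by have := normr_ge0 x; lra.
exists (Num.min d (`|x| + 1)^-1); first by rewrite lt_min d0 invr_gt0.
move=> q Wq /andP[h0]; rewrite lt_min => /andP[hd hx] qx.
apply: K => //; first by rewrite h0.
have : (`|x| + 1) * q.2 <= 1 by rewrite -ler_pdivlMl // mulr1 ltW.
apply: le_trans; rewrite expr1 ler_wpM2r ?(ltW h0) //.
have := ler_normD (q.1 - x) x; rewrite subrK; lra.
Qed.

Lemma inside_near S W p : (forall q, S q -> 0 < q.2 -> W q) -> 0 < p.2 ->
  exists2 d : R, 0 < d & forall q,
    `|q.1 - p.1| < d -> `|q.2 - p.2| < d -> S q -> W q /\ 0 < q.2.
Proof.
move=> SW p0; exists p.2 => // q _ qp Sq.
have q0 : 0 < q.2 by move: qp; rewrite ltr_norml => /andP[]; lra.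
by split => //; exact: SW.
Qed.

(** Being O(h^2), a negligible function extended by 0 has zero derivatives at
    h = 0. *)
Lemma has_partial_extend0 b S W f df p : hopen S ->
  (forall q, S q -> 0 < q.2 -> W q) -> flat W f ->
  (forall q, W q -> has_partial b W f q (df q)) -> S p ->
  has_partial b S (extend0 f) p (extend0 df p).
Proof.
move=> oS SW Ff Hf Sp; have [p0 _] := oS _ Sp.
move: p0; rewrite le_eqVlt => /orP[/eqP p0|p0].
  rewrite {2}/extend0 -p0 ltxx; case: b {Hf}; last first.
    apply: dq_local (@dq_cst _ setT 0); first by rewrite shift0 /extend0 -p0 ltxx.
    by exists 1 => // r _ _; rewrite /extend0 /= -p0 ltxx.
  have [d d0 K] := flat_near p.1 Ff.
  apply/dqP => e e0; exists (Num.min d e); first by rewrite lt_min d0.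
  move=> r /= Sr r0; rewrite lt_min => /andP[rd re].
  rewrite subr0 /extend0 /= -p0 !add0r ltxx subr0.
  case: ifPn => rp; last by rewrite mul0r normr0.
  rewrite gtr0_norm // in rd re; rewrite normrM normfV (gtr0_norm rp).
  rewrite ltr_pdivrMr //.
  apply: le_lt_trans (_ : r ^+ 2 < _); last by rewrite expr2 ltr_pM2r.
  have -> : r ^+ 2 = (p.1, r).2 ^+ 2 by [].
  apply: K; rewrite /= ?subrr ?normr0 ?rp //.
  by apply: SW => //; move: Sr; rewrite /shift -p0 add0r.
have -> : extend0 df p = df p by rewrite /extend0 p0.
apply: has_partial_local (Hf p (SW _ Sp p0)); first by rewrite /extend0 p0.
have [d d0 K] := inside_near SW p0; exists d => // q h1 h2 Sq.
by have [Wq q0] := K q h1 h2 Sq; rewrite /extend0 q0.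
Qed.

Lemma Cn_extend0 Q Q' S W n f : hopen S ->
  (forall p, S p -> 0 < p.2 -> W p) ->
  (forall u, Q u -> flat W u) -> (forall u, Q u -> Q' (extend0 u)) ->
  Cn Q W n f -> Cn Q' S n (extend0 f).
Proof.
move=> oS SW Qf QQ'.
have cont u : Q u -> {within W, continuous u} -> {within S, continuous (extend0 u)}.
  move=> Qu /continuous_withinP cu; apply/continuous_withinP => p Sp e e0.
  have [p0 _] := oS _ Sp; move: p0; rewrite le_eqVlt => /orP[/eqP p0|p0].
    have [d d0 K] := flat_near p.1 (Qf _ Qu).
    exists (Num.min (Num.min d 1) e); first by rewrite !lt_min d0 e0 ltr01.
    move=> q Sq; rewrite !lt_min => /andP[/andP[h1 h1'] _] /andP[/andP[h2 h2'] h2''].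
    rewrite /extend0 -p0 ltxx subr0; case: ifPn => q0; last by rewrite normr0.
    move: h2 h2' h2''; rewrite -p0 subr0 gtr0_norm // => h2 h2' h2''.
    apply: le_lt_trans h2''; apply: le_trans (K q (SW _ Sq q0) _ h1') _.
      by rewrite q0.
    by rewrite expr2 ler_piMl // ltW.
  have [d d0 K] := inside_near SW p0; have [d' d'0 K'] := cu _ (SW _ Sp p0) e e0.
  exists (Num.min d d'); first by rewrite lt_min d0.
  move=> q Sq; rewrite !lt_min => /andP[h1 h1'] /andP[h2 h2'].
  have [Wq q0] := K q h1 h2 Sq.
  by rewrite /extend0 p0 q0; apply: K'.
elim: n f => [|n IH] f Cf; split; try by [apply/QQ'/(Cn_bound Cf)|
  apply/cont; [exact: (Cn_bound Cf)|exact: (Cn_cont Cf)]|].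
have Qf0 := Cn_bound Cf; case: Cf => _ _ [D HD].
exists (fun b => extend0 (D b)) => b; have [h1 k1] := HD b.
split; last exact: IH.
by move=> p Sp; apply: has_partial_extend0 (Qf _ Qf0) h1 Sp.
Qed.

End FlatCalculus.

(** * Domains adjacent to an interval *)

Section Domains.
Variable R : realType.
Implicit Types (J : set R) (p q : R * R) (S U V W : set (R * R)).

Lemma adjacent_hopen J U : adjacent J U -> hopen (U `|` axis J).
Proof.
move=> [oU _ U0 _ HJ] p [Up|Jp].
  split; first exact/ltW/U0.
  have : \forall q \near p, U q by exact: open_nbhs_nbhs.
  by apply: filterS => q Uq _; left.
split; last exact: HJ.
by case: Jp => _ /= ->.
Qed.

Lemma open_hopen U : open U -> U `<=` [set p | 0 < p.2] -> hopen U.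
Proof.
move=> oU U0 p Up; split; first exact/ltW/U0.
have : \forall q \near p, U q by exact: open_nbhs_nbhs.
by apply: filterS.
Qed.

Lemma pair_continuous_within (T : topologicalType) (A : set T) (u v : T -> R) :
  {within A, continuous u} -> {within A, continuous v} ->
  {within A, continuous (fun x => (u x, v x))}.
Proof.
move=> /subspace_continuousP cu /subspace_continuousP cv.
by apply/subspace_continuousP => x Ax; exact: cvg_pair (cu x Ax) (cv x Ax).
Qed.

Lemma within_cont_comp (T : topologicalType) (A : set T) (c : T -> R * R) S
    (f : R * R -> R) :
  (forall x, A x -> S (c x)) -> {within A, continuous c} ->
  {within S, continuous f} -> {within A, continuous (fun x => f (c x))}.
Proof.
move=> AS /subspace_continuousP cc /subspace_continuousP cf.
apply/subspace_continuousP => x Ax; apply/cvgrPdist_lt => e e0.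
have /cvgrPdist_lt/(_ e e0) := cf _ (AS _ Ax); rewrite near_withinE => H.
have AA : \forall z \near within A (nbhs x), A z by exact: withinT.
apply: filterS2 AA (cc x Ax _ H) => z Az; apply; exact: AS.
Qed.

Lemma within_cont_vertical (A : set R) (x : R) S (f : R * R -> R) :
  (forall h, A h -> S (x, h)) -> {within S, continuous f} ->
  {within A, continuous (fun h => f (x, h))}.
Proof.
move=> AS; apply: within_cont_comp AS _; apply: pair_continuous_within.
  by apply: continuous_subspaceT => h; exact: cvg_cst.
by apply: continuous_subspaceT => h; exact: cvg_id.
Qed.

Lemma within_cont_horizontal (A : set R) (h : R) S (f : R * R -> R) :
  (forall x, A x -> S (x, h)) -> {within S, continuous f} ->
  {within A, continuous (fun x => f (x, h))}.
Proof.
move=> AS; apply: within_cont_comp AS _; apply: pair_continuous_within.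
  by apply: continuous_subspaceT => x; exact: cvg_id.
by apply: continuous_subspaceT => x; exact: cvg_cst.
Qed.

Lemma connected_graph (A : set R) (u v : R -> R) :
  connected A -> {within A, continuous u} -> {within A, continuous v} ->
  connected [set (u x, v x) | x in A].
Proof.
move=> cA cu cv; apply: connected_continuous_connected => //.
exact: pair_continuous_within.
Qed.

Lemma connected_rectangle (A B : set R) : connected A -> connected B ->
  connected (A `*` B).
Proof.
move=> cA cB; have [->|/set0P[y0 By0]] := eqVneq B set0.
  by rewrite setX0; exact: connected0.
have [->|/set0P[x0 Ax0]] := eqVneq A set0.
  by rewrite set0X; exact: connected0.
have -> : A `*` B = \bigcup_(y in B)
    ([set (x, y) | x in A] `|` [set (x0, z) | z in B]).
  apply/seteqP; split=> [[x y] [/= Ax By]|q [y By] [[x Ax <-]|[z Bz <-]]] //.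
  by exists y => //; left; exists x.
have id_cont (C : set R) : {within C, continuous (fun x : R => x)}.
  by apply: continuous_subspaceT => x; exact: cvg_id.
have cst_cont (C : set R) (z : R) : {within C, continuous (fun _ : R => z)}.
  by apply: continuous_subspaceT => x; exact: cvg_cst.
apply: bigcup_connected; first by exists (x0, y0) => y _; right; exists y0.
move=> y By; apply: connectedU; last 2 first.
- exact: (@connected_graph A (fun x => x) (fun _ => y)).
- exact: (@connected_graph B (fun _ => x0) (fun z => z)).
by exists (x0, y); split; [exists x0|exists y].
Qed.

Lemma connected_axis J : is_interval J -> connected (axis J).
Proof.
move=> /connected_intervalP cJ; apply: connected_rectangle => //.
exact: connected1.
Qed.

Definition box (a b r : R) : set (R * R) := `]a, b[ `*` `]0, r[.

Lemma boxP (a b r : R) q : box a b r q <-> (a < q.1 < b) /\ (0 < q.2 < r).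
Proof. by rewrite /box /setX /= !in_itv. Qed.

Lemma box_near (a b r : R) p : a < p.1 < b -> `|p.2| < r -> a < b ->
  \forall q \near p, a < q.1 < b /\ `|q.2| < r.
Proof.
move=> /andP[ap pb] pr ab.
apply/near_planeP.
exists (Num.min (Num.min (p.1 - a) (b - p.1)) (r - `|p.2|)).
  by rewrite !lt_min !subr_gt0 ap pb.
move=> q; rewrite !lt_min => /andP[/andP[h1 h2] _] /andP[_ h3].
move: h1 h2; rewrite !ltr_norml => /andP[? ?] /andP[? ?].
split; first by apply/andP; split; lra.
rewrite -ltr_norml; apply: le_lt_trans (_ : `|q.2 - p.2| + `|p.2| < r); last lra.
by have := ler_normD (q.2 - p.2) p.2; rewrite subrK.
Qed.

Lemma open_box (a b r : R) : open (box a b r).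
Proof.
rewrite openE => p /boxP[h1 /andP[h2 h3]].
have ab : a < b by case/andP: h1 => *; exact: lt_trans (_ : p.1 < b).
have : \forall q \near p, 0 < q.2.
  apply/near_planeP; exists p.2 => // q _; rewrite ltr_norml => /andP[? _]; lra.
have p2r : `|p.2| < r by rewrite gtr0_norm.
apply: filterS2 (box_near h1 p2r ab) => q [k1 k2] q0.
by apply/boxP; rewrite q0 -(gtr0_norm q0).
Qed.

Lemma box_hopen (a b r : R) : hopen (box a b r).
Proof. by apply: open_hopen; [exact: open_box|move=> p /boxP[_ /andP[]]]. Qed.

(** The union of the open boxes with a base containing 0 is a connected domain,
    and its horizontal sections are intervals containing 0: invariance can then
    be propagated along each section. *)
Lemma star_domain J W : open J -> is_interval J -> J 0 ->
  (forall x, J x -> \forall q \near (x, 0), 0 < q.2 -> W q) ->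
  exists V, [/\ adjacent J V, V `<=` W &
    forall p, V p -> forall y, 0 <= y <= p.1 \/ p.1 <= y <= 0 -> V (y, p.2)].
Proof.
move=> oJ iJ J0 HW.
pose P (i : R * R * R) := [/\ i.1.1 < 0, 0 < i.1.2, 0 < i.2 &
  box i.1.1 i.1.2 i.2 `<=` W].
pose V := \bigcup_(i in P) box i.1.1 i.1.2 i.2.
have PJ x : J x -> exists2 i, P i & i.1.1 < x < i.1.2.
  move=> Jx; pose m := Num.min 0 x; pose M := Num.max 0 x.
  have [Jm JM] : J m /\ J M.
    by rewrite /m /M; case: leP => _ //; split.
  have [m0 M0] : m <= 0 /\ 0 <= M by rewrite /m /M ge_min le_max lexx.
  have [mx xM] : m <= x /\ x <= M by rewrite /m /M ge_min le_max lexx !orbT.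
  have [e e0 He] : exists2 e : R, 0 < e &
      (forall y, m - e <= y <= M + e -> J y).
    have [e1 e10 H1] : exists2 e : R, 0 < e & forall y, `|y - m| < e -> J y.
      by apply/near_lineP; exact: open_nbhs_nbhs.
    have [e2 e20 H2] : exists2 e : R, 0 < e & forall y, `|y - M| < e -> J y.
      by apply/near_lineP; exact: open_nbhs_nbhs.
    have me : 0 < Num.min e1 e2 by rewrite lt_min e10.
    have m1 : Num.min e1 e2 <= e1 by rewrite ge_min lexx.
    have m2 : Num.min e1 e2 <= e2 by rewrite ge_min lexx orbT.
    exists (Num.min e1 e2 / 2); first by lra.
    move=> y /andP[h1 h2]; apply: (iJ (m - Num.min e1 e2 / 2) (M + Num.min e1 e2 / 2)).
    - by apply: H1; rewrite addrAC subrr add0r normrN gtr0_norm; lra.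
    - by apply: H2; rewrite addrAC subrr add0r gtr0_norm; lra.
    - by rewrite h1 h2.
  have [r r0 Hr] := @tube R (fun q => 0 < q.2 -> W q) (m - e) (M + e) 0
    (fun y ye => HW y (He y ye)).
  exists (m - e, M + e, r) => /=; last by apply/andP; split; lra.
  split => //=; try lra.
  move=> q /boxP[/andP[q1 q2] /andP[q3 q4]].
  rewrite (surjective_pairing q); apply: Hr => //.
    by apply/andP; split; lra.
  by rewrite subr0 gtr0_norm.
have V0 : V `<=` [set p | 0 < p.2].
  by move=> p [[[a b] r] /= _] /boxP[_ /andP[]].
exists V; split; last first.
- move=> p [[[a b] r] /= Pi] /boxP[/andP[h1 h2] h3] y hy.
  exists (a, b, r) => //; apply/boxP; split => //=.
  by case: Pi => /= a0 b0 r0 _; case: hy => /andP[? ?]; apply/andP; split; lra.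
- by move=> p [i [_ _ _ iW]] /iW.
have [i0 Pi0 _] := PJ 0 J0.
have near_axis x : J x -> \forall q \near (x, 0), 0 < q.2 -> V q.
  move=> /PJ[[[a b] r] /= Pi xi]; have [/= a0 b0 r0 _] := Pi.
  have := @box_near a b r (x, 0) xi; rewrite normr0 => /(_ r0).
  have ab : a < b by lra.
  move=> /(_ ab); apply: filterS => q [h1 h2] q0.
  exists (a, b, r) => //; apply/boxP; split => //.
  by rewrite q0 /= -(gtr0_norm q0).
split => //.
- by apply: bigcup_open => i _; exact: open_box.
- have -> : V = \bigcup_(i in P) (box i.1.1 i.1.2 i.2 `|` box i0.1.1 i0.1.2 i0.2).
    apply/seteqP; split=> [q [i Pi iq]|q [i Pi [iq|iq]]].
    + by exists i => //; left.
    + by exists i.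
    + by exists i0.
  have cbox i : connected (box i.1.1 i.1.2 i.2).
    by apply: connected_rectangle; apply/connected_intervalP; exact: interval_is_interval.
  have [a0 b0 r0 _] := Pi0.
  apply: bigcup_connected.
    exists (0, i0.2 / 2) => i _; right; apply/boxP => /=.
    by rewrite a0 b0; split => //; apply/andP; split; lra.
  move=> i Pi; apply: connectedU => //.
  have [a1 b1 r1 _] := Pi.
  pose m := Num.min i.2 i0.2; have m0 : 0 < m by rewrite lt_min r0 r1.
  have m1 : m <= i.2 by rewrite ge_min lexx.
  have m2 : m <= i0.2 by rewrite ge_min lexx orbT.
  exists (0, m / 2); split; apply/boxP => /=; rewrite ?a0 ?b0 ?a1 ?b1.
    by split => //; apply/andP; split; lra.
  by split => //; apply/andP; split; lra.
- move=> [x h] [/= Jx ->]; split; last first.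
    by move=> /interior_subset /V0 /=; rewrite ltxx.
  move=> B /= /near_planeP[e e0 He].
  have /near_planeP[d d0 Hd] := near_axis x Jx.
  pose m := Num.min e d; have m0 : 0 < m by rewrite lt_min e0 d0.
  have m1 : m <= e by rewrite ge_min lexx.
  have m2 : m <= d by rewrite ge_min lexx orbT.
  exists (x, m / 2); split.
    by apply: Hd; rewrite /= ?subrr ?subr0 ?normr0 // ?gtr0_norm; lra.
  by apply: He; rewrite /= ?subrr ?subr0 ?normr0 // ?gtr0_norm; lra.
- move=> [x h] [/= Jx ->]; apply: filterS2 (near_axis x Jx) _; last first.
    have [e e0 He] : exists2 e : R, 0 < e & forall y, `|y - x| < e -> J y.
      by apply/near_lineP; exact: open_nbhs_nbhs.
    have : \forall q \near (x, 0 : R), J q.1.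
      by apply/near_planeP; exists e => // q h1 _; apply: He.
    exact.
  move=> q Vq Jq /=; rewrite le_eqVlt => /orP[/eqP q0|q0]; last by left; exact: Vq.
  by right; split.
Qed.

Lemma adjacent_inter J U1 U2 : open J -> is_interval J -> J 0 ->
  adjacent J U1 -> adjacent J U2 ->
  exists U, [/\ adjacent J U, U `<=` U1 & U `<=` U2].
Proof.
move=> oJ iJ J0 [_ _ _ _ H1] [_ _ _ _ H2].
have [|V [aV VW _]] := @star_domain J (U1 `&` U2) oJ iJ J0.
  move=> x Jx; have Ax : axis J (x, 0) by [].
  apply: filterS2 (H1 _ Ax) (H2 _ Ax) => q K1 K2 q0.
  have nJ : ~ axis J q by case=> _ /= q00; rewrite q00 ltxx in q0.
  by split; [case: (K1 (ltW q0))|case: (K2 (ltW q0))].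
by exists V; split => // p /VW[].
Qed.

End Domains.

(** * Leaves and germs of foliations *)

Section Leaves.
Variable R : realType.
Implicit Types (J : set R) (p q : R * R) (S U V W : set (R * R)).
Implicit Types (k g f : R * R -> R).

Lemma leaf_refl S k p : S p -> leaf S k p p.
Proof. by move=> Sp; apply: connected_component_refl. Qed.

Lemma leaf_sub S k p q : leaf S k p q -> S q /\ k q = k p.
Proof. by move=> /connected_component_sub. Qed.

Lemma leaf_same S k p q : leaf S k p q -> leaf S k p = leaf S k q.
Proof.
move=> Lpq; have [_ E] := leaf_sub Lpq.
by rewrite /leaf E; exact: same_connected_component.
Qed.

Lemma leaves_eq_leaf S k1 k2 p : leaves S k1 = leaves S k2 -> S p ->
  leaf S k1 p = leaf S k2 p.
Proof.
move=> E Sp; have : leaves S k1 (leaf S k1 p) by exists p.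
rewrite E => -[q Sq Lq]; rewrite -Lq.
by apply: leaf_same; rewrite Lq; exact: leaf_refl.
Qed.

Lemma eq_leaves S k1 k2 : (forall p, S p -> leaf S k1 p = leaf S k2 p) ->
  leaves S k1 = leaves S k2.
Proof.
move=> E; apply/seteqP; split=> L [p Sp <-]; exists p => //.
  exact/esym/E.
exact: E.
Qed.

Lemma eq_levels_leaves S k1 k2 :
  (forall p q, S p -> S q -> k1 q = k1 p <-> k2 q = k2 p) ->
  leaves S k1 = leaves S k2.
Proof.
move=> E; apply: eq_leaves => p Sp; congr connected_component.
by apply/seteqP; split=> q [Sq kq]; split => //; apply/(E _ _ Sp Sq).
Qed.

(** The leaves on a domain determine those on a smaller one: a connected subset
    of a level set of k1 lies in a leaf of k1, that is, of k2. *)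
Lemma leaves_sub S S' k1 k2 : S' `<=` S ->
  leaves S k1 = leaves S k2 -> leaves S' k1 = leaves S' k2.
Proof.
move=> SS E.
suff H k k' p : leaves S k = leaves S k' -> S' p -> leaf S' k p `<=` leaf S' k' p.
  by apply: eq_leaves => p Sp; apply/seteqP; split; apply: H.
move=> {}E Sp; apply: connected_component_max; last exact: component_connected.
  exact: leaf_refl.
move=> q Lq; have [Sq _] := leaf_sub Lq; split => //.
suff : leaf S k' p q by move=> /leaf_sub[].
rewrite -(leaves_eq_leaf E (SS _ Sp)).
apply: connected_component_max Lq; first exact: leaf_refl.
  by move=> z /leaf_sub[Sz kz]; split => //; exact: SS.
exact: component_connected.
Qed.

Lemma same_germ_refl J U k : adjacent J U -> same_foliation_germ J U k U k.
Proof. by move=> aU; exists U; split. Qed.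

Lemma same_germ_sym J U1 k1 U2 k2 :
  same_foliation_germ J U1 k1 U2 k2 -> same_foliation_germ J U2 k2 U1 k1.
Proof. by move=> [U [aU s1 s2 E]]; exists U; split. Qed.

Lemma same_germ_trans J U1 k1 U2 k2 U3 k3 : open J -> is_interval J -> J 0 ->
  same_foliation_germ J U1 k1 U2 k2 -> same_foliation_germ J U2 k2 U3 k3 ->
  same_foliation_germ J U1 k1 U3 k3.
Proof.
move=> oJ iJ J0 [U [aU s1 s2 E]] [U' [aU' s1' s2' E']].
have [V [aV VU VU']] := adjacent_inter oJ iJ J0 aU aU'.
exists V; split => //; [exact: subset_trans s1|exact: subset_trans s2'|].
rewrite (leaves_sub _ E); last by apply: setSU.
by apply: leaves_sub E'; apply: setSU.
Qed.

Lemma same_germ_restrict J U1 k1 U2 k2 : open J -> is_interval J -> J 0 ->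
  adjacent J U1 -> adjacent J U2 ->
  (forall p, (U1 `&` U2 `|` axis J) p -> k1 p = k2 p) ->
  same_foliation_germ J U1 k1 U2 k2.
Proof.
move=> oJ iJ J0 aU1 aU2 E.
have [V [aV VU VU']] := adjacent_inter oJ iJ J0 aU1 aU2.
have E' p : (V `|` axis J) p -> k1 p = k2 p.
  by move=> [Vp|Jp]; apply: E; [left; split; auto|right].
exists V; split => //; apply: eq_levels_leaves => p q Sp Sq.
by rewrite !E'.
Qed.

Definition increasing_height S k :=
  forall p, S p -> exists2 l, has_partial2 S k p l & 0 < l.

Lemma increasing_height_lt S k x a b : increasing_height S k -> a < b ->
  (forall h, a <= h <= b -> S (x, h)) -> k (x, a) < k (x, b).
Proof.
move=> H ab HS.
have /choice[dk Hdk] : forall p, exists l, S p -> has_partial2 S k p l /\ 0 < l.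
  move=> p; have [Sp|nSp] := pselect (S p); last by exists 0.
  by have [l h1 h2] := H p Sp; exists l.
have s0 : 0 < b - a by rewrite subr_gt0.
have [||t /andP[t0 ts]] := @has_partial_MVT _ true S k dk (x, a) (b - a) s0.
- by move=> t /andP[t0 ts]; apply: HS; rewrite /=; apply/andP; split; lra.
- by move=> q Sq; apply/has_partial2E/(Hdk q Sq).1.
rewrite /shift /= [a + (b - a)]addrC subrK => E.
rewrite -subr_gt0 E mulr_gt0 //; apply: (Hdk _ _).2; apply: HS.
by apply/andP; split; lra.
Qed.

Lemma increasing_height_sub S S' k g : S' `<=` S ->
  (forall p, S' p -> k p = g p) -> increasing_height S k ->
  increasing_height S' g.
Proof.
move=> SS kg H p Sp; have [l /has_partial2E h l0] := H p (SS _ Sp).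
exists l => //; apply/has_partial2E.
apply: has_partial_local h; first exact: kg.
by exists 1 => // q _ _ Sq; split; [exact: SS|exact: kg].
Qed.

Lemma positive_inside U k p : open U -> U `<=` [set p | 0 < p.2] ->
  (forall q, U q -> 0 <= k q) -> increasing_height U k -> U p -> 0 < k p.
Proof.
move=> oU U0 k0 ik Up; have [p0 [e e0 He]] := hopenP (open_hopen oU U0) Up.
pose m := Num.min e p.2; have pp : 0 < p.2 := U0 _ Up.
have m0 : 0 < m by rewrite lt_min e0 pp.
have [m1 m2] : m <= e /\ m <= p.2 by rewrite !ge_min !lexx orbT.
have HU h : p.2 - m / 2 <= h <= p.2 -> U (p.1, h).
  move=> /andP[h1 h2]; apply: He => /=; rewrite ?subrr ?normr0 //; last lra.
  by rewrite ltr_norml; apply/andP; split; lra.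
have lt : p.2 - m / 2 < p.2 by lra.
have := increasing_height_lt ik lt HU; rewrite -surjective_pairing.
by apply: le_lt_trans; apply: k0; apply: HU; apply/andP; split; lra.
Qed.

(** On the domain a function with these properties is positive, so that its zero
    level is the interval J, which is a leaf as it is connected. *)
Lemma invariant_foliationI (F : R * R -> R * R) J U k :
  is_interval J -> J 0 -> adjacent J U ->
  smooth_on (U `|` axis J) k ->
  (forall p, U p -> 0 <= k p) -> (forall p, axis J p -> k p = 0) ->
  increasing_height (U `|` axis J) k ->
  (forall p, (U `|` axis J) p -> (U `|` axis J) (F p) -> k (F p) = k p) ->
  invariant_foliation F J U k.
Proof.
move=> iJ J0 aU smk k0 kJ ik kF; have [oU _ U0 _ _] := aU.
have ikU : increasing_height U k by apply: increasing_height_sub ik => // p; left.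
split => //; split; first split => //.
  by move=> p [Up|/kJ ->]; [exact: k0|].
have A0 : axis J (0, 0) by [].
exists (0, 0); first by right.
rewrite /leaf (_ : _ `&` _ = axis J).
  by apply: connected_component_id => //; exact: connected_axis.
apply/seteqP; split=> p; last by move=> Jp; split; [right|rewrite /= !kJ].
move=> [[Up|//]] /=; rewrite (kJ _ A0) => kp0.
by have := positive_inside oU U0 k0 ikU Up; rewrite kp0 ltxx.
Qed.

Lemma partial_derivatives_sub S S' f g D : S' `<=` S ->
  (forall p, S' p -> f p = g p) ->
  partial_derivatives S f D -> partial_derivatives S' g D.
Proof.
move=> SS fg [D0 HD]; split; first by move=> p Sp; rewrite D0 ?fg //; exact: SS.
move=> i j; have [h1 h2 h3] := HD i j; split.
- exact: within_cont_sub h1.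
- move=> p Sp; have := h2 _ (SS _ Sp); move/has_partial1E => h; apply/has_partial1E.
  by apply: has_partial_local h => //; exists 1 => // q _ _ /SS.
- move=> p Sp; have := h3 _ (SS _ Sp); move/has_partial2E => h; apply/has_partial2E.
  by apply: has_partial_local h => //; exists 1 => // q _ _ /SS.
Qed.

Lemma invariant_foliation_sub (F : R * R -> R * R) J U V k g :
  is_interval J -> J 0 -> adjacent J V -> V `<=` U ->
  (forall p, (V `|` axis J) p -> k p = g p) ->
  invariant_foliation F J U k -> invariant_foliation F J V g.
Proof.
move=> iJ J0 aV VU kg [aU [[[D HD] k0 kJ ik kF] _]].
have SS : V `|` axis J `<=` U `|` axis J by apply: setSU.
apply: invariant_foliationI => //.
- by exists D; apply: partial_derivatives_sub HD.
- by move=> p Vp; rewrite -kg; [apply: k0; left; exact: VU|left].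
- by move=> p Jp; rewrite -kg; [apply: kJ|right].
- exact: increasing_height_sub ik.
- by move=> p Sp SFp; rewrite -!kg // kF //; exact: SS.
Qed.

(** Implicit functions of a strictly increasing equation are continuous; the
    solution may lie at an end of the interval of heights. *)
Lemma implicit_continuous (T : topologicalType) (A : set T)
    (E : T -> R -> R) (d : R) (y : T -> R) :
  (forall x, A x -> 0 <= y x <= d /\ E x (y x) = 0) ->
  (forall x s t, A x -> 0 <= s -> s < t -> t <= d -> E x s < E x t) ->
  (forall s, 0 <= s <= d -> {within A, continuous (fun x => E x s)}) ->
  {within A, continuous y}.
Proof.
move=> Hy inc cE; apply/subspace_continuousP => x Ax; apply/cvgrPdist_lt => e e0.
have [/andP[y0 yd] Ey] := Hy x Ax.
have Fx : Filter (within A (nbhs x)) by exact: within_filter.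
have up : \forall z \near within A (nbhs x), A z -> y z < y x + e.
  have [le|lt] := leP (y x + e / 2) d; last first.
    by near=> z => Az; have [/andP[_]] := Hy z Az; lra.
  have sd : 0 <= y x + e / 2 <= d by apply/andP; split; lra.
  have s0 : 0 < E x (y x + e / 2) by rewrite -Ey; apply: inc => //; lra.
  have /subspace_continuousP/(_ x Ax)/cvgrPdist_lt/(_ _ s0) := cE _ sd.
  apply: filterS => z; rewrite ltr_norml => /andP[_ zs] Az.
  have [/andP[z0 zd] Ez] := Hy z Az.
  have [//|ge] := ltP (y z) (y x + e).
  have {}zs : E x (y x + e / 2) - E z (y x + e / 2) < E x (y x + e / 2) := zs.
  have : E z (y x + e / 2) < E z (y z) by apply: inc => //; lra.
  rewrite Ez; lra.
have down : \forall z \near within A (nbhs x), A z -> y x - e < y z.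
  have [le|lt] := leP 0 (y x - e / 2); last first.
    by near=> z => Az; have [/andP[]] := Hy z Az; lra.
  have sd : 0 <= y x - e / 2 <= d by apply/andP; split; lra.
  have s0 : 0 < - E x (y x - e / 2).
    by rewrite oppr_gt0 -[X in _ < X]Ey; apply: inc => //; lra.
  have /subspace_continuousP/(_ x Ax)/cvgrPdist_lt/(_ _ s0) := cE _ sd.
  apply: filterS => z; rewrite ltr_norml => /andP[zs _] Az.
  have [/andP[z0 zd] Ez] := Hy z Az.
  have [//|ge] := ltP (y x - e) (y z).
  have {}zs : - - E x (y x - e / 2) < E x (y x - e / 2) - E z (y x - e / 2) := zs.
  have : E z (y z) < E z (y x - e / 2) by apply: inc => //; lra.
  rewrite Ez; lra.
have AA : \forall z \near within A (nbhs x), A z by exact: withinT.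
near=> z; have Az : A z by near: z.
have : y z < y x + e by near: z; apply: filterS2 up AA => z; exact.
have : y x - e < y z by near: z; apply: filterS2 down AA => z; exact.
by move=> ? ?; rewrite ltr_norml /=; apply/andP; split; rewrite /from_subspace; lra.
Unshelve. all: by end_near. Qed.

(** Near the origin the leaves are graphs that cross the line tau = 0, where a
    normalized function takes the value h: the foliation determines it. *)
Lemma germ_determines_function J U1 k1 U2 k2 : J 0 ->
  {within U1 `|` axis J, continuous k1} ->
  increasing_height (U1 `|` axis J) k1 ->
  (forall p, axis J p -> k1 p = 0) ->
  (exists2 d : R, 0 < d & forall h, 0 <= h < d -> k1 (0, h) = h /\ k2 (0, h) = h) ->
  same_foliation_germ J U1 k1 U2 k2 ->
  exists2 d : R, 0 < d & forall p, `|p.1| < d -> 0 < p.2 < d -> k1 p = k2 p.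
Proof.
move=> J0 ck1 ik1 k1J [d0 d00 norm] [U [aU UU1 _ E]].
have A0 : axis J (0, 0) by [].
have [_ [e e0 He]] := hopenP (adjacent_hopen aU) (or_intror A0).
set S := U `|` axis J in E He.
have SS : S `<=` U1 `|` axis J by apply: setSU.
have ck : {within S, continuous k1} by exact: within_cont_sub ck1.
have ik : increasing_height S k1 by exact: increasing_height_sub ik1.
pose d := Num.min e d0 / 2.
have [dd [de dd0]] : 0 < d /\ d < e /\ d < d0.
  have : 0 < Num.min e d0 by rewrite lt_min e0 d00.
  have : Num.min e d0 <= e by rewrite ge_min lexx.
  have : Num.min e d0 <= d0 by rewrite ge_min lexx orbT.
  by rewrite /d; split; [|split]; lra.
have HS x h : `|x| <= d -> 0 <= h <= d -> S (x, h).
  move=> xd /andP[h0 hd]; apply: He => //=; rewrite subr0; first exact: le_lt_trans de.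
  by rewrite ger0_norm //; exact: le_lt_trans de.
have kd : k1 (0, d) = d by apply: (norm _ _).1; rewrite dd0 ltW.
have k0 x : `|x| <= d -> k1 (x, 0) = 0.
  move=> xd; have [|Ux|Jx] := HS x 0 xd; first by rewrite lexx ltW.
    by case: aU => _ _ U0 _ _; have := U0 _ Ux; rewrite /= ltxx.
  exact: k1J.
have d2 : 0 < d / 2 by lra.
have n0 : `|(0 : R)| <= d by rewrite normr0 ltW.
move/continuous_withinP : (ck) => ck'.
have [d1 d10 H1] : exists2 a : R, 0 < a & forall q, S q -> `|q.1 - 0| < a ->
    `|q.2 - d| < a -> `|k1 q - k1 (0, d)| < d / 2.
  by apply: (ck' (0, d)) => //; apply: HS => //; rewrite lexx ltW.
have [d3 d30 H3] : exists2 a : R, 0 < a & forall q, S q -> `|q.1 - 0| < a ->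
    `|q.2 - 0| < a -> `|k1 q - k1 (0, 0)| < d / 2.
  by apply: (ck' (0, 0)) => //; apply: HS => //; rewrite lexx ltW.
pose m := Num.min (Num.min d1 d3) d.
have m0 : 0 < m by rewrite !lt_min d10 d30 dd.
have [m1 m3 md] : [/\ m <= d1, m <= d3 & m <= d] by rewrite !ge_min !lexx ?orbT.
exists m => // -[x0 h0] /= x0m /andP[h00 h0m].
have xd (x : R) : `|x| < m -> `|x| <= d by move=> xm; lra.
have top x : `|x| < m -> d / 2 < k1 (x, d).
  move=> xm; have /= := H1 (x, d) (HS x d (xd x xm) _).
  rewrite lexx ltW // !subr0 subrr normr0 kd => /(_ erefl).
  move=> /(_ (lt_le_trans xm m1) d10); rewrite ltr_norml => /andP[? _]; lra.
pose c := k1 (x0, h0).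
have inc x s t : `|x| < m -> 0 <= s -> s < t -> t <= d -> k1 (x, s) < k1 (x, t).
  move=> xm s0 st td; apply: increasing_height_lt ik _ _ => // h /andP[sh ht].
  by apply: HS; [exact: xd|apply/andP; split; lra].
have h0d : h0 <= d by lra.
have c0 : 0 < c by rewrite -(k0 x0 (xd _ x0m)); apply: inc.
have c2 : c < d / 2.
  have /= := H3 (x0, h0) (HS x0 h0 (xd _ x0m) _); rewrite (ltW h00) h0d !subr0.
  move=> /(_ erefl (lt_le_trans x0m m3)); rewrite gtr0_norm //.
  move=> /(_ (lt_le_trans h0m m3)); rewrite (k0 _ n0) subr0 gtr0_norm //.
pose A := [set x : R | `|x| < m].
have /choice[y Hy] : forall x, exists y, A x -> 0 <= y <= d /\ k1 (x, y) - c = 0.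
  move=> x; have [Ax|nAx] := pselect (A x); last by exists 0.
  have [||y yd ky] := @IVT R (fun h => k1 (x, h)) 0 d c (ltW dd).
  - apply: within_cont_vertical ck => h; rewrite /= in_itv /=.
    exact: HS (xd x Ax).
  - rewrite (k0 x (xd x Ax)) ge_min le_max (ltW c0) /=.
    by rewrite (ltW (lt_trans c2 (top x Ax))) orbT.
  - by exists y => _; rewrite ky subrr; split => //; move: yd; rewrite in_itv.
have cy : {within A, continuous y}.
  apply: (@implicit_continuous _ A (fun x s => k1 (x, s) - c) d) => //.
    by move=> x s t Ax s0 st td; rewrite ltrD2r; exact: inc.
  move=> s sd; apply: (@within_cont_horizontal R A s S (fun q => k1 q - c)).
    by move=> x Ax; apply: HS => //; exact: xd.
  by apply: within_contD ck _; apply: continuous_subspaceT => q; exact: cvg_cst.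
have uniq x s : A x -> 0 <= s <= d -> k1 (x, s) = c -> s = y x.
  move=> Ax /andP[s0 sd] ks; have [/andP[y0 yd] /eqP] := Hy x Ax.
  rewrite subr_eq0 => /eqP ky; apply/eqP; rewrite eq_le !leNgt; apply/andP; split.
    by apply/negP => /(inc x _ _ Ax y0)/(_ sd); rewrite ks ky ltxx.
  by apply/negP => /(inc x _ _ Ax s0)/(_ yd); rewrite ks ky ltxx.
have Ax0 : A x0 by [].
have A00 : A 0 by rewrite /A /= normr0.
have h0y : h0 = y x0 by apply: uniq => //; rewrite h0d ltW.
have S0 : S (x0, h0) by apply: HS; [exact: xd|rewrite h0d ltW].
have cA : connected A.
  apply/connected_intervalP => a b; rewrite /A /= !ltr_norml.
  by move=> /andP[? ?] /andP[? ?] z /andP[? ?]; rewrite ltr_norml; apply/andP; split; lra.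
have L : leaf S k1 (x0, h0) (0, y 0).
  apply: (@connected_component_max _ _ [set (x, y x) | x in A]); last by exists 0.
  - by exists x0 => //; rewrite -h0y.
  - move=> _ [x Ax <-]; have [yd /eqP] := Hy x Ax; rewrite subr_eq0 => /eqP ky.
    by split=> //; apply: HS => //; exact: xd.
  - apply: (@connected_graph _ A (fun x => x) y cA) => //.
    by apply: continuous_subspaceT => x; exact: cvg_id.
have [/andP[y0 yd] _] := Hy 0 A00.
have [n1 n2] : k1 (0, y 0) = y 0 /\ k2 (0, y 0) = y 0.
  by apply: norm; rewrite y0 /=; exact: le_lt_trans dd0.
have [_] := leaf_sub L; rewrite n1 => <-.
by move: L; rewrite (leaves_eq_leaf E S0) => /leaf_sub[_]; rewrite n2.
Qed.

End Leaves.

(** * From flat functions to foliations *)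

Section FromFlatFunctions.
Variables (R : realType) (c : map_case).
Implicit Types (J : set R) (p q : R * R) (S U V W : set (R * R)).
Implicit Types (k g f psi : R * R -> R).

Local Notation s := (@shift_length R c).

Definition shift_exponent : R := match c with CaseI => 2^-1 | CaseII => 1 end.

Lemma shift_length0 : s 0 = 0.
Proof. by rewrite /shift_length; case: c => //; exact: sqrtr0. Qed.

Lemma shift_length_gt0 h : 0 < h -> 0 < s h.
Proof. by rewrite /shift_length; case: c => // h0; rewrite sqrtr_gt0. Qed.

Lemma shift_length_small (d : R) : 0 < d ->
  exists2 e : R, 0 < e & forall h, 0 <= h < e -> s h < d.
Proof.
move=> d0; rewrite /shift_length; case: c; last by exists d => // h /andP[].
exists (d ^+ 2); first by rewrite exprn_gt0.
move=> h /andP[h0 hd]; rewrite -(ltr_pXn2r (n := 2)) ?nnegrE ?sqrtr_ge0 ?ltW //.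
by rewrite sqr_sqrtr.
Qed.

Lemma dq_sqrt (h : R) : 0 < h ->
  dq setT (fun r => Num.sqrt (h + r)) (2^-1 * (Num.sqrt h / h)).
Proof.
move=> h0; have F : Filter (within setT (0 : R)^') by exact: within_filter.
have s0 : 0 < Num.sqrt h by rewrite sqrtr_gt0.
have C : Num.sqrt (h + r) @[r --> within setT (0 : R)^'] --> Num.sqrt h.
  apply: cvg_within_filter; apply: cvg_within_filter.
  rewrite -[X in _ --> Num.sqrt X]addr0.
  apply: continuous_comp; last exact: sqrt_continuous.
  by apply: cvgD; [exact: cvg_cst|exact: cvg_id].
have D : (Num.sqrt (h + r) + Num.sqrt h)^-1 @[r --> within setT (0 : R)^']
    --> (Num.sqrt h + Num.sqrt h)^-1.
  apply: cvgV; first by rewrite gt_eqF // addr_gt0.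
  by apply: cvgD C _; exact: cvg_cst.
have E : 2^-1 * (Num.sqrt h / h) = (Num.sqrt h + Num.sqrt h)^-1.
  by rewrite -{2}(sqr_sqrtr (ltW h0)); field; rewrite !gt_eqF ?addr_gt0.
rewrite E; apply: cvg_near_eq D.
rewrite !near_withinE; apply/near_lineP; exists h => // r; rewrite subr0 => rh r0 _.
rewrite addr0.
have hr : 0 <= h + r by move: rh; rewrite ltr_norml => /andP[]; lra.
have t0 : 0 < Num.sqrt (h + r) + Num.sqrt h by apply: ltr_wpDl => //; exact: sqrtr_ge0.
have rE : r = (Num.sqrt (h + r) - Num.sqrt h) * (Num.sqrt (h + r) + Num.sqrt h).
  by rewrite -subr_sqr !sqr_sqrtr ?(ltW h0) // addrAC subrr add0r.
have nz : Num.sqrt (h + r) - Num.sqrt h != 0.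
  apply: contra r0; rewrite subr_eq0 => /eqP e.
  have := sqr_sqrtr hr; rewrite e sqr_sqrtr ?(ltW h0) // => /eqP.
  by rewrite -subr_eq0 opprD addrA subrr add0r oppr_eq0.
by rewrite [X in _ = _ / X]rE; field; rewrite nz gt_eqF.
Qed.

Lemma power_scale_shift : power_scale s shift_exponent.
Proof.
move=> h h0; rewrite /shift_length /shift_exponent; case: c; split => //.
- by rewrite sqrtr_gt0.
- exact: dq_sqrt.
- move=> h1; apply: mulr_ile1; rewrite ?sqrtr_ge0 ?(ltW h0) //.
  by rewrite -sqrtr1 ler_wsqrtr.
- by rewrite divff ?gt_eqF // mulr1; exact: dq_shift.
- by move=> h1; apply: mulr_ile1; rewrite ?(ltW h0).
Qed.

Lemma power_scale_inv_shift :
  power_scale (fun h => (s h)^-1) (- shift_exponent).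
Proof.
move=> h h0; have s0 := shift_length_gt0 h0; have [_ D _] := power_scale_shift h0.
split; first by rewrite invr_gt0.
- have := dqV _ D; rewrite addr0 => /(_ (lt0r_neq0 s0)).
  congr dq; field; rewrite ?gt_eqF //.
- move=> h1; rewrite mulrC ler_pdivrMr // mul1r /shift_length.
  case: c => //; rewrite -{1}(sqr_sqrtr (ltW h0)) expr2 ler_piMl ?sqrtr_ge0 //.
  by rewrite -sqrtr1 ler_wsqrtr.
Qed.

Lemma Fmap0 p : p.2 = 0 -> Fmap c p = p.
Proof.
by move=> p0; rewrite /Fmap p0 shift_length0 addr0 -p0 -surjective_pairing.
Qed.

Lemma periodic_int (u : R -> R) : (forall t, u (t + 1) = u t) ->
  forall (z : int) t, u (t + z%:~R) = u t.
Proof.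
move=> H; have N n t : u (t + n%:R) = u t.
  elim: n => [|n IH] in t *; first by rewrite addr0.
  by rewrite -natr1 addrA H IH.
by case=> n t; [rewrite N | rewrite NegzE mulrNz -(N n.+1) subrK].
Qed.

(** If all the derivatives in a family vanish at h = 0, boundedness near h = 0
    improves to decay of every order: integrate in h, once for each power. *)
Lemma vanishing_decay S (D : nat -> nat -> R * R -> R) (X : set R) (e : R) : 0 < e ->
  (forall i j p, S p -> has_partial2 S (D i j) p (D i j.+1 p)) ->
  (forall x h, X x -> 0 <= h < e -> S (x, h)) ->
  (forall i j x, X x -> D i j (x, 0) = 0) ->
  (forall i j, exists2 d : R, 0 < d &
     forall x h, X x -> 0 < h < d -> `|D i j (x, h)| <= 1) ->
  forall N i j, exists2 d : R, 0 < d &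
     forall x h, X x -> 0 < h < d -> `|D i j (x, h)| <= h ^+ N.
Proof.
move=> e0 HD HS D0 Dbd; elim=> [|N IH] i j.
  have [d d0 H] := Dbd i j; exists d => // x h Xx hd; rewrite expr0; exact: H.
have [d d0 H] := IH i j.+1; exists (Num.min d e); first by rewrite lt_min d0.
move=> x h Xx /andP[h0]; rewrite lt_min => /andP[hd he].
have [||t /andP[t0 th]] := @has_partial_MVT _ true S (D i j) (D i j.+1) (x, 0) h h0.
- move=> t /andP[t0 th]; rewrite /shift /= add0r; apply: HS => //.
  by rewrite t0 /=; exact: le_lt_trans he.
- by move=> q Sq; apply/has_partial2E/HD.
rewrite /shift /= !add0r D0 // subr0 => ->.
rewrite normrM (gtr0_norm h0) exprSr ler_pM2r //.
apply: le_trans (H x t Xx _) _; first by rewrite t0 /=; exact: lt_trans hd.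
by rewrite lerXn2r ?nnegrE ?(ltW h0) ?(ltW t0) // ltW.
Qed.

Definition open_strip (eps : R) : set (R * R) := [set p | 0 < p.2 < eps].

Lemma strip_hopen (eps : R) : hopen (strip eps).
Proof.
move=> p /andP[p0 pe]; split => //; apply/near_planeP.
exists (eps - p.2); first by rewrite subr_gt0.
move=> q _; rewrite ltr_norml => /andP[_ h] q0; apply/andP; split => //; lra.
Qed.

Lemma open_strip_hopen (eps : R) : hopen (open_strip eps).
Proof.
move=> p /andP[p0 pe]; split; first exact: ltW.
apply/near_planeP; exists (Num.min p.2 (eps - p.2)).
  by rewrite lt_min p0 subr_gt0.
move=> q _; rewrite lt_min !ltr_norml => /andP[/andP[h1 h2] /andP[h3 h4]] q0.
by apply/andP; split; lra.
Qed.

(** The limits in the definition of flatness are taken over h > 0; continuity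
    transfers them to the boundary circle. *)
Lemma flat_function_boundary eps psi D i j t : 0 < eps ->
  partial_derivatives (strip eps) psi D ->
  (forall i j (e : R), 0 < e -> \forall h \near 0^'+, forall t, `|D i j (t, h)| < e) ->
  D i j (t, 0) = 0.
Proof.
move=> eps0 [_ HD] fl; apply/eqP; rewrite -normr_le0; apply/ler_addgt0Pl => e e0.
have [/continuous_withinP cD _ _] := HD i j.
have S0 : strip eps (t, 0) by rewrite /strip /= lexx.
have e2 : 0 < e / 2 by lra.
have [d d0 H] := cD _ S0 _ e2.
have := fl i j _ e2; rewrite near_withinE => /near_lineP[d' d'0 H'].
pose m := Num.min (Num.min d d') eps; have m0 : 0 < m by rewrite !lt_min d0 d'0.
have [m1 m2 m3] : [/\ m <= d, m <= d' & m <= eps] by rewrite !ge_min !lexx ?orbT.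
have h0 : 0 < m / 2 by lra.
have A : `|D i j (t, m / 2) - D i j (t, 0)| < e / 2.
  apply: H; rewrite /= ?subrr ?subr0 ?normr0 // ?gtr0_norm //; try lra.
  by rewrite /strip /=; apply/andP; split; lra.
have B : `|D i j (t, m / 2)| < e / 2.
  by apply: H' => //; rewrite subr0 gtr0_norm //; lra.
have := ler_normB (D i j (t, m / 2)) (D i j (t, m / 2) - D i j (t, 0)).
by rewrite subKr; lra.
Qed.

Lemma flat_function_Cinfty eps psi : flat_function eps psi ->
  Cinfty (flat (open_strip eps)) (open_strip eps) psi.
Proof.
move=> [eps0 _ _ [D HD fl]].
have SW : open_strip eps `<=` strip eps.
  by move=> p /andP[p0 pe]; rewrite /strip /= ltW.
have decay : forall N i j, exists2 d : R, 0 < d &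
    forall x h, setT x -> 0 < h < d -> `|D i j (x, h)| <= h ^+ N.
  apply: (@vanishing_decay (strip eps) D setT eps) => //.
  - by move=> i j p Sp; have [_ _] := HD.2 i j; exact.
  - by move=> i j x _; exact: flat_function_boundary HD fl.
  - move=> i j; have := fl i j 1 ltr01; rewrite near_withinE => /near_lineP[d d0 H].
    exists d => // x h _ /andP[h0 hd]; apply: ltW; apply: H => //.
    by rewrite subr0 gtr0_norm.
have FD i j : flat (open_strip eps) (D i j).
  move=> N; have [d d0 H] := decay N i j; exists d => // -[x h] /= _ hd _.
  exact: H.
apply: (smooth_Cinfty (partial_derivatives_sub SW _ HD)) => //.
move=> N; have [d d0 H] := FD 0%N 0%N N; exists d => // p Wp h1 h2.
by rewrite -HD.1; [exact: H|exact: SW].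
Qed.

Lemma flat_function_zero eps psi t : flat_function eps psi -> psi (t, 0) = 0.
Proof.
move=> [eps0 _ _ [D HD fl]]; rewrite -HD.1; first exact: flat_function_boundary HD fl.
by rewrite /strip /= lexx.
Qed.

Lemma gfunE eps psi p : flat_function eps psi -> 0 <= p.2 ->
  gfun c psi p = p.2 + extend0 (fun q => psi (q.1 * (s q.2)^-1, q.2)) p.
Proof.
move=> H; rewrite /gfun /extend0 le_eqVlt => /orP[/eqP <-|-> //].
by rewrite ltxx (flat_function_zero _ H).
Qed.

Lemma gfun_axis eps psi p : flat_function eps psi -> p.2 = 0 -> gfun c psi p = 0.
Proof. by move=> H p0; rewrite (gfunE H) p0 // /extend0 p0 ltxx addr0. Qed.

Lemma gfun_normalized eps psi h : flat_function eps psi -> 0 <= h < eps ->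
  gfun c psi (0, h) = h.
Proof. by move=> [_ _ psi0 _] he; rewrite /gfun /= mul0r psi0 // addr0. Qed.

Lemma gfun_invariant eps psi p : flat_function eps psi -> 0 <= p.2 < eps ->
  gfun c psi (Fmap c p) = gfun c psi p.
Proof.
move=> [_ per _ _] /andP[]; rewrite le_eqVlt => /orP[/eqP p0 _|p0 pe].
  by rewrite Fmap0.
rewrite /gfun /Fmap /= mulrDl divff; last by rewrite gt_eqF // shift_length_gt0.
by rewrite per // ltW.
Qed.

Lemma rescaled_Cinfty eps psi : flat_function eps psi ->
  Cinfty (flat (open_strip eps)) (open_strip eps)
    (fun q => psi (q.1 * (s q.2)^-1, q.2)).
Proof.
move=> H n; apply: Cn_rescale power_scale_inv_shift _ _ _ _
  (flat_function_Cinfty H n); try exact: open_strip_hopen.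
- by move=> p /andP[].
- by [].
Qed.

Lemma gfun_Cinfty eps psi S : flat_function eps psi -> hopen S ->
  S `<=` strip eps -> Cinfty (@no_bound R) S (gfun c psi).
Proof.
move=> H oS Seps n.
apply: (@Cn_eq _ _ _ _ (fun p => p.2 +
    extend0 (fun q => psi (q.1 * (s q.2)^-1, q.2)) p)) => //.
  by move=> p Sp; rewrite (gfunE H) //; case: (oS _ Sp).
apply: CnD => //; first exact: Cn_snd.
apply: Cn_extend0 (rescaled_Cinfty H n) => //.
by move=> p /Seps/andP[_ pe] p0; apply/andP.
Qed.

(** Near the axis the perturbation of h and its derivative in h are O(h), hence
    the positivity of the function and of its derivative. *)
Lemma gfun_foliation eps psi J : open J -> is_interval J -> J 0 ->
  flat_function eps psi ->
  exists2 V, V `<=` strip eps & invariant_foliation (@Fmap R c) J V (gfun c psi).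
Proof.
move=> oJ iJ J0 H; set W := open_strip eps.
pose f q := psi (q.1 * (s q.2)^-1, q.2).
have [Ff _ [D HD]] := rescaled_Cinfty H 1%N.
have [h2 k2] := HD true; have FD : flat W (D true) by case: k2.
have eps0 : 0 < eps by case: H.
have [d d0 Hf] := Ff 1%N; have [d' d'0 HDt] := FD 1%N.
pose m := Num.min (Num.min d d') (Num.min eps 1).
have m0 : 0 < m by rewrite !lt_min d0 d'0 eps0 ltr01.
have [md md' me m1] : [/\ m <= d, m <= d', m <= eps & m <= 1].
  by rewrite !ge_min !lexx ?orbT.
clearbody m.
(* The bounds on f and on its derivative in h hold where |tau| <= 1 / h, which
   is a neighbourhood of the whole axis, also for an unbounded interval J. *)
pose W' := [set p : R * R | 0 < p.2 < m /\ `|p.1| * p.2 < 1].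
have [|V [aV VW' _]] := @star_domain R J W' oJ iJ J0.
  move=> x _; have x1 : 0 < `|x| + 1 by have := normr_ge0 x; lra.
  apply/near_planeP; exists (Num.min (Num.min m 1) (`|x| + 1)^-1).
    by rewrite !lt_min m0 ltr01 invr_gt0.
  move=> q /=; rewrite !lt_min subr0 => /andP[/andP[_ q1] _].
  move=> /andP[/andP[qm _] qx] q0; rewrite gtr0_norm // in qm qx.
  split; first by rewrite q0.
  have : (`|x| + 1) * q.2 < 1 by rewrite -ltr_pdivlMl // mulr1.
  apply: le_lt_trans; rewrite ler_pM2r //.
  have := ler_normD (q.1 - x) x; rewrite subrK; lra.
have V0 p : V p -> [/\ W p, 0 < p.2, p.2 < 1, `|f p| <= p.2 & `|D true p| <= p.2].
  move=> /VW'[/andP[p0 pm] p1].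
  have pe : p.2 < eps := lt_le_trans pm me.
  have Wp : W p by apply/andP.
  split => //; first exact: lt_le_trans m1.
    by have := Hf p Wp; rewrite p0 (lt_le_trans pm md) !expr1; apply => //; rewrite ltW.
  by have := HDt p Wp; rewrite p0 (lt_le_trans pm md') !expr1; apply => //; rewrite ltW.
have Seps : V `|` axis J `<=` strip eps.
  move=> p [/V0[/andP[p0 pe] _ _ _ _]|[_ /= p0]]; rewrite /strip /=.
    by rewrite ltW.
  by rewrite p0 lexx.
have oS := adjacent_hopen aV.
exists V; first by move=> p Vp; apply: Seps; left.
apply: invariant_foliationI => //.
- have [|E HE _] := Cinfty_smooth oS _ (gfun_Cinfty H oS Seps) => //.
  by exists E.
- move=> p /V0[_ p0 _]; rewrite (gfunE H) ?(ltW p0) // /extend0 p0 ler_norml.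
  by rewrite /f => /andP[? _] _; lra.
- by move=> p [_ /= p0]; exact: gfun_axis H p0.
- move=> p Sp; exists (1 + extend0 (D true) p); last first.
    rewrite /extend0; case: ifPn => p0; last by rewrite addr0.
    case: Sp => [/V0[_ _ p1 _]|[_ /= p00]]; last by rewrite p00 ltxx in p0.
    by rewrite ler_norml => /andP[? _]; lra.
  apply/has_partial2E.
  have SW q : (V `|` axis J) q -> 0 < q.2 -> W q.
    by move=> [/V0[]//|[_ /= ->]]; rewrite ltxx.
  have K := has_partialD (@has_partial_snd R true (V `|` axis J) p)
    (has_partial_extend0 oS SW Ff h2 Sp).
  apply: (has_partial_local _ _ K).
    by rewrite -(gfunE H) //; case: (oS _ Sp).
  by exists 1 => // q _ _ Sq; split => //; rewrite -(gfunE H) //; case: (oS _ Sq).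
- by move=> p /Seps pe _; exact: gfun_invariant H pe.
Qed.

(** At height h one period of psi is seen on an interval of length s h around the
    line tau = 0, which is contained in any neighbourhood of the origin for h
    small. *)
Lemma gfun_determines eps1 psi1 eps2 psi2 :
  flat_function eps1 psi1 -> flat_function eps2 psi2 ->
  (exists2 d : R, 0 < d & forall p, `|p.1| < d -> 0 < p.2 < d ->
     gfun c psi1 p = gfun c psi2 p) ->
  same_function_germ eps1 psi1 eps2 psi2.
Proof.
move=> H1 H2 [d d0 E]; have [e e0 He] := shift_length_small d0.
have [eps10 per1 _ _] := H1; have [eps20 per2 _ _] := H2.
exists (Num.min (Num.min eps1 eps2) (Num.min d e)); split.
- by rewrite !lt_min eps10 eps20 d0.
- by rewrite !ge_min lexx.
- by rewrite !ge_min lexx orbT.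
move=> [t h] /andP[/= h0]; rewrite !lt_min => /andP[/andP[he1 he2] /andP[hd he]].
move: h0; rewrite le_eqVlt => /orP[/eqP <-|h0].
  by rewrite (flat_function_zero _ H1) (flat_function_zero _ H2).
pose z := Num.floor t; pose r := t - z%:~R.
have -> : t = r + z%:~R by rewrite /r subrK.
rewrite (periodic_int (u := fun t => psi1 (t, h))); last by move=> x; rewrite per1 // ltW.
rewrite (periodic_int (u := fun t => psi2 (t, h))); last by move=> x; rewrite per2 // ltW.
have /andP[r0 r1] : 0 <= r <= 1.
  have /andP[] := real_floor_itv (num_real t); rewrite intrD1 /r => ? ?.
  by apply/andP; split; rewrite /z; lra.
have s0 := shift_length_gt0 h0.
have := E (r * s h, h); rewrite /gfun /= mulfK ?gt_eqF //.
rewrite h0 hd => /(_ _ erefl) K; apply: (addrI h); apply: K.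
rewrite ger0_norm; last by rewrite mulr_ge0 // ltW.
have sd : s h < d by apply: He; rewrite he ltW.
by apply: le_lt_trans sd; rewrite ler_piMl // ltW.
Qed.

End FromFlatFunctions.

(** * Normalization of an invariant function *)

Section Normalization.
Variable R : realType.
Implicit Types (J : set R) (p q : R * R) (S U V W : set (R * R)).
Implicit Types (k g f psi : R * R -> R).

Lemma hopen_sublevel S k (m : R) : hopen S -> {within S, continuous k} ->
  hopen [set p | S p /\ k p < m].
Proof.
move=> oS /continuous_withinP ck p [Sp km].
have [p0 [e e0 He]] := hopenP oS Sp; split => //; apply/near_planeP.
have km0 : 0 < m - k p by rewrite subr_gt0.
have [d d0 Hd] := ck p Sp _ km0; exists (Num.min e d); first by rewrite lt_min e0.
move=> q; rewrite !lt_min => /andP[e1 d1] /andP[e2 d2] q0.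
have Sq := He q e1 e2 q0; split => //.
by have := Hd q Sq d1 d2; rewrite ltr_norml => /andP[_]; lra.
Qed.

Lemma has_partial_vertical S f (x b y l : R) :
  (forall t, 0 <= t <= b -> S (x, t)) -> has_partial true S f (x, y) l ->
  dq [set r | 0 <= y + r <= b] (fun r => f (x, y + r)) l.
Proof. by move=> HS; apply: dq_local => //; exists 1 => // r _ /HS. Qed.

Lemma Cn_comp_vertical S S' (D : nat -> nat -> R * R -> R) g (x b : R) n j :
  (forall y, 0 <= y <= b -> S (x, y)) ->
  (forall j, {within S, continuous (D 0%N j)}) ->
  (forall j p, S p -> has_partial true S (D 0%N j) p (D 0%N j.+1 p)) ->
  (forall p, S' p -> 0 <= g p <= b) ->
  Cn (@no_bound R) S' n g -> Cn (@no_bound R) S' n (fun p => D 0%N j (x, g p)).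
Proof.
move=> HS cD HD gb.
have cont j' : {within S', continuous g} ->
    {within S', continuous (fun p => D 0%N j' (x, g p))}.
  move=> cg; apply: (@within_cont_comp _ _ S' (fun p => (x, g p)) S) => //.
    by move=> p /gb/HS.
  apply: pair_continuous_within => //.
  by apply: continuous_subspaceT => p; exact: cvg_cst.
elim: n j => [|n IH] j Cg; split => //; try exact/cont/(Cn_cont Cg).
have CI := IH j.+1 (CnS Cg).
case: Cg => _ _ [E HE].
exists (fun a p => D 0%N j.+1 (x, g p) * E a p) => a; have [h1 k1] := HE a.
split; last exact: (@CnM _ (@no_bound R) (@no_bound R)).
move=> p Sp; have := h1 p Sp; rewrite /has_partial => h.
apply: (dq_comp (B := [set y | 0 <= y <= b]) (chi := fun y => D 0%N j (x, y)) h).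
  by exists 1 => // r _ /gb.
rewrite shift0; exact: has_partial_vertical HS (HD _ _ (HS _ (gb _ Sp))).
Qed.

(** Composing k with the inverse of h |-> k (0, h) yields a function with the
    same level curves that restricts to h on the line tau = 0. It is smooth: its
    first derivatives are rational in those of k and in the function itself. *)
Lemma normal_form (F : R * R -> R * R) J U k : J 0 ->
  invariant_foliation F J U k ->
  exists S g, 
   [/\ [/\ hopen S, S `<=` U `|` axis J & axis J `<=` S],
    [/\ Cinfty (@no_bound R) S g, increasing_height S g,
      forall p, S p -> 0 <= g p & forall p, axis J p -> g p = 0],
    (exists2 b : R, 0 < b & forall h, 0 <= h < b -> S (0, h) /\ g (0, h) = h),
    (forall p q, S p -> S q -> (g q = g p <-> k q = k p)) &
    forall p, S p -> S (F p) -> g (F p) = g p].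
Proof.
move=> J0 [aU [[[D HD] k0 kJ ik kF] _]].
set S := U `|` axis J in HD k0 kJ ik kF *.
have oS : hopen S by exact: adjacent_hopen.
have A0 : axis J (0, 0) by [].
have [_ [e e0 He]] := hopenP oS (or_intror A0).
have ck : {within S, continuous k} by apply: smooth_on_cont; exists D.
pose b := e / 2; have b0 : 0 < b by rewrite /b; lra.
have HS h : 0 <= h <= b -> S (0, h).
  move=> /andP[h0 hb]; apply: He => //=; first by rewrite subrr normr0.
  by rewrite subr0 ger0_norm //; rewrite /b in hb; lra.
have inc s t : 0 <= s -> s < t -> t <= b -> k (0, s) < k (0, t).
  move=> s0 st tb; apply: increasing_height_lt ik _ _ => // h /andP[sh ht].
  by apply: HS; apply/andP; split; lra.
have inj s t : 0 <= s <= b -> 0 <= t <= b -> k (0, s) = k (0, t) -> s = t.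
  move=> /andP[s0 sb] /andP[t0 tb] E; apply/eqP; rewrite eq_le !leNgt.
  apply/andP; split; apply/negP => /inc.
    by move=> /(_ t0 sb); rewrite E ltxx.
  by move=> /(_ s0 tb); rewrite E ltxx.
pose S1 := [set p | S p /\ k p < k (0, b)].
have oS1 : hopen S1 by exact: hopen_sublevel.
have S1S : S1 `<=` S by move=> p [].
have kb : 0 < k (0, b).
  by have := inc 0 b (lexx 0) b0 (lexx b); rewrite (kJ _ A0).
have /choice[g Hg] : forall p, exists y, S1 p -> 0 <= y <= b /\ k (0, y) = k p.
  move=> p; have [[Sp kp]|nS] := pselect (S1 p); last by exists 0.
  have [||y yb ky] := @IVT R (fun h => k (0, h)) 0 b (k p) (ltW b0).
  - apply: within_cont_vertical ck => h; rewrite /= in_itv /=; exact: HS.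
  - by rewrite (kJ _ A0) ge_min le_max k0 //= (ltW kp) orbT.
  - by exists y => _; split => //; move: yb; rewrite in_itv.
have gb p : S1 p -> 0 <= g p <= b by move=> /Hg[].
have kg p : S1 p -> k (0, g p) = k p by move=> /Hg[].
have cg : {within S1, continuous g}.
  apply: (@implicit_continuous _ _ S1 (fun p y => k (0, y) - k p) b).
  - by move=> p Sp; split; [exact: gb|rewrite kg // subrr].
  - by move=> p s t _ s0 st tb; rewrite ltrD2r; exact: inc.
  - move=> s _; apply: within_contD; first by move=> ?; exact: cvg_cst.
    have /subspace_continuousP ck1 : {within S1, continuous k} by exact: within_cont_sub ck.
    by apply/subspace_continuousP => p Sp; apply: cvgN; exact: ck1.
have [D0 HD1] := HD.
have HD2 j p : S p -> has_partial true S (D 0%N j) p (D 0%N j.+1 p).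
  by move=> Sp; have [_ _ /(_ p Sp)/has_partial2E] := HD1 0%N j.
have D1pos p : S p -> 0 < D 0%N 1%N p.
  move=> Sp; have [l /has_partial2E h l0] := ik p Sp.
  suff -> : D 0%N 1%N p = l by [].
  apply: (has_partial_unique oS Sp (HD2 0%N p Sp)).
  apply: has_partial_local h; first by rewrite D0.
  by exists 1 => // q _ _ Sq; rewrite D0.
have kD (a : bool) p : S p ->
    has_partial a S k p (if a then D 0%N 1%N p else D 1%N 0%N p).
  move=> Sp; have [_ h1 h2] := HD1 0%N 0%N.
  apply: (@has_partial_local _ _ S S (D 0%N 0%N)); first by rewrite D0.
    by exists 1 => // q _ _ Sq; rewrite D0.
  by case: a; [exact/has_partial2E/h2|exact/has_partial1E/h1].
have gD (a : bool) p : S1 p -> has_partial a S1 g p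
    ((if a then D 0%N 1%N p else D 1%N 0%N p) / D 0%N 1%N (0, g p)).
  move=> Sp; have Sg := HS _ (gb _ Sp).
  apply: (dq_implicit (B := [set y | 0 <= y <= b]) (v := fun r => k (shift a p r))
    (chi := fun y => k (0, y))).
  - by rewrite gt_eqF // D1pos.
  - move/continuous_withinP : cg => /(_ p Sp) cg.
    apply/cvgrPdist_lt => eta eta0; rewrite !near_withinE; apply/near_lineP.
    have [d d0 H] := cg eta eta0; exists d => // r; rewrite subr0 => rd _ Sr.
    rewrite shift0 distrC; have [s1 s2] := shift_near a p d0 rd; exact: H.
  - by exists 1 => // r _ Sr; split; [exact: gb|exact: kg].
  - by rewrite !shift0 kg.
  - by rewrite shift0; apply: has_partial_vertical HS (kD true (0, g p) Sg).
  - have := kD a p (S1S _ Sp); rewrite /has_partial.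
    by apply: dq_local => //; exists 1 => // r _ /S1S.
have Cg : Cinfty (@no_bound R) S1 g.
  have CD i j n : Cn (@no_bound R) S1 n (D i j).
    have HDij : partial_derivatives S (D i j) (fun i' j' => D (i + i')%N (j + j')%N).
      split; first by rewrite !addn0.
      by move=> i' j'; rewrite !addnS; exact: HD1.
    exact: Cn_sub S1S _ _ _ (@smooth_Cinfty _ (@no_bound R) _ _ _ HDij
      (fun _ _ => I) I n).
  elim=> [|n IH]; split => //.
  exists (fun a p => (if a then D 0%N 1%N p else D 1%N 0%N p) * (D 0%N 1%N (0, g p))^-1).
  move=> a; split; first exact: gD.
  apply: (@CnM _ (@no_bound R) (@no_bound R)) => //.
    by case: (a).
  apply: CnV; first by move=> p Sp; rewrite gt_eqF // D1pos //; apply: HS; exact: gb.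
  apply: (@Cn_comp_vertical S S1 D g 0 b n 1%N HS) => //.
  by move=> j; have [] := HD1 0%N j.
exists S1, g; split.
- split => // p Jp; split; first by right.
  by rewrite kJ.
- split => //.
  + move=> p Sp; exists (D 0%N 1%N p / D 0%N 1%N (0, g p)).
      exact/has_partial2E/(gD true p Sp).
    by rewrite divr_gt0 // D1pos //; [exact: S1S|apply: HS; exact: gb].
  + by move=> p /gb/andP[].
  + move=> p Jp; have Sp : S1 p by split; [right|rewrite kJ].
    by apply: inj; rewrite ?gb ?lexx ?ltW // kg // !kJ.
- exists b => // h /andP[h0 hb]; have hb' : 0 <= h <= b by rewrite h0 ltW.
  have Sh : S1 (0, h) by split; [exact: HS|exact: inc].
  by split => //; apply: inj; rewrite ?gb // kg.
- move=> p q Sp Sq; split => [E|E]; first by rewrite -(kg p) // -(kg q) // E.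
  by apply: inj; rewrite ?gb // !kg.
- by move=> p Sp SFp; apply: inj; rewrite ?gb // !kg // kF //; exact: S1S.
Qed.

End Normalization.

(** * From foliations to flat functions *)

Section FromFoliations.
Variables (R : realType) (c : map_case).
Implicit Types (J : set R) (p q : R * R) (S U V W : set (R * R)).
Implicit Types (k g f psi : R * R -> R).

Local Notation s := (@shift_length R c).

(** Invariance at height h propagates along an interval by any integer number
    of steps, as the intermediate points stay in the interval. *)
Lemma invariant_shift (u : R -> R) (P : R -> Prop) (step : R) : 0 < step ->
  (forall x y z, P x -> P z -> x <= y <= z -> P y) ->
  (forall x, P x -> P (x + step) -> u (x + step) = u x) ->
  forall (m : int) x, P x -> P (x + m%:~R * step) -> u (x + m%:~R * step) = u x.
Proof.
move=> step0 Pc Hu.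
have N (n : nat) x : P x -> P (x + n%:R * step) -> u (x + n%:R * step) = u x.
  elim: n => [|n IH] Px; first by rewrite mul0r addr0.
  rewrite -natr1 mulrDl mul1r addrA => Pxn.
  have n0 : 0 <= n%:R * step by rewrite mulr_ge0 // ltW.
  have Pn : P (x + n%:R * step).
    by apply: Pc Px Pxn _; rewrite lerDl n0 lerDl ltW.
  by rewrite Hu // IH.
case=> n x Px; first exact: N.
rewrite NegzE mulrNz mulNr => Pn; rewrite -(N n.+1) //; last by rewrite subrK.
by rewrite subrK.
Qed.

Lemma zeros_to_axis S (u : R * R -> R) (d : R) : {within S, continuous u} ->
  (forall x h, 0 <= x <= d -> 0 <= h <= d -> S (x, h)) ->
  (forall x eta : R, 0 <= x <= d -> 0 < eta -> exists x' h,
     [/\ 0 <= x' <= d, `|x' - x| < eta, 0 < h < eta, h <= d & u (x', h) = 0]) ->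
  forall x, 0 <= x <= d -> u (x, 0) = 0.
Proof.
move=> /continuous_withinP cu HS Z x xd.
have d0 : 0 <= d by case/andP: xd => *; exact: le_trans (_ : x <= d).
apply/eqP; rewrite -normr_le0; apply/ler_addgt0Pl => e e0; rewrite addr0.
have Sx : S (x, 0) by apply: HS; rewrite ?lexx.
have [a a0 H] := cu _ Sx e e0.
have [x' [h [x'd x'x /andP[h0 ha] hd u0]]] := Z x a xd a0.
have := H (x', h) (HS _ _ x'd _); rewrite /= (ltW h0) hd subr0 (gtr0_norm h0) u0 sub0r normrN.
by move=> /(_ erefl x'x ha) /ltW.
Qed.

(** All the derivatives vanish on the axis as soon as the function has zeros
    accumulating, from above, at each of its points: by Rolle's theorem so does
    the next derivative in h, once the previous one vanishes on the axis. *)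
Lemma zeros_vanishing S f D (d : R) : 0 < d -> partial_derivatives S f D ->
  hopen S -> (forall x h, 0 <= x <= d -> 0 <= h <= d -> S (x, h)) ->
  (forall x eta : R, 0 <= x <= d -> 0 < eta -> exists x' h,
     [/\ 0 <= x' <= d, `|x' - x| < eta, 0 < h < eta, h <= d & f (x', h) = 0]) ->
  forall i j x, 0 <= x < d -> D i j (x, 0) = 0.
Proof.
move=> d0 [D0 HD] oS HS Z.
have HZ j : (forall x eta : R, 0 <= x <= d -> 0 < eta -> exists x' h,
   [/\ 0 <= x' <= d, `|x' - x| < eta, 0 < h < eta, h <= d & D 0%N j (x', h) = 0]).
  elim: j => [|j IH] x eta xd eta0.
    have [x' [h [H1 H2 H3 H4 H5]]] := Z x eta xd eta0; exists x', h.
    by split => //; rewrite D0 //; apply: HS => //; case/andP: H3 => *; rewrite ltW.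
  have [x' [h [H1 H2 /andP[h0 he] hd H5]]] := IH x eta xd eta0.
  have [cD _ HD2] := HD 0%N j.
  have [||t /andP[t0 th]] := @has_partial_MVT _ true S (D 0%N j) (D 0%N j.+1) (x', 0) h h0.
  - move=> t /andP[t0 th]; rewrite /shift /= add0r; apply: HS => //.
    by rewrite t0 /=; exact: le_trans hd.
  - by move=> q Sq; apply/has_partial2E/HD2.
  rewrite /shift /= !add0r H5 (zeros_to_axis cD HS IH H1) subrr => /esym/eqP.
  rewrite mulf_eq0 (gt_eqF h0) orbF => /eqP E.
  exists x', t; split => //; first by rewrite t0 /=; exact: lt_trans he.
  by apply: le_trans hd; exact: ltW.
elim=> [|i IH] j x /andP[x0 xd].
  have [cD _ _] := HD 0%N j; apply: (zeros_to_axis cD HS (HZ j)).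
  by rewrite x0 ltW.
have Sx : S (x, 0) by apply: HS; rewrite ?lexx ?x0 ltW.
have [_ /(_ _ Sx)/has_partial1E h _] := HD i j.
have K : dq [set r : R | 0 < r < d - x] (fun _ => 0 : R) (D i.+1 j (x, 0)).
  apply: dq_local h; first by rewrite shift0 IH // x0.
  exists 1 => // r _ /andP[r0 rd]; have xr : 0 <= x + r < d.
    by apply/andP; split; lra.
  split; last by rewrite /shift /= IH.
  apply: HS; rewrite ?lexx ?(ltW d0) //=; case/andP: xr => -> /ltW //.
apply: dq_unique K (@dq_cst _ _ 0).
by exists (d - x) => //; rewrite subr_gt0.
Qed.

(** The orbit of (0, h) has step s h and starts on the line tau = 0: for h small
    it passes close to every point of the axis. *)
Lemma grid_zeros g (d : R) : 0 < d ->
  (forall x h, 0 <= x -> x + s h <= d -> 0 < h <= d -> g (x + s h, h) = g (x, h)) ->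
  (forall h, 0 < h <= d -> g (0, h) = h) ->
  forall x eta : R, 0 <= x <= d -> 0 < eta -> exists x' h,
    [/\ 0 <= x' <= d, `|x' - x| < eta, 0 < h < eta, h <= d & g (x', h) = h].
Proof.
move=> d0 inv norm x eta /andP[x0 xd] eta0.
have [e e0 He] := shift_length_small c eta0.
pose m := Num.min eta (Num.min e d).
have m0 : 0 < m by rewrite !lt_min eta0 e0 d0.
have [m1 m2 m3] : [/\ m <= eta, m <= e & m <= d] by rewrite !ge_min !lexx ?orbT.
clearbody m; pose h := m / 2; have h0 : 0 < h by rewrite /h; lra.
have [heta he hd] : [/\ h < eta, h < e & h <= d] by rewrite /h; split; lra.
clearbody h; have s0 : 0 < s h := shift_length_gt0 c h0.
pose n := Num.truncn (x / s h).
have xs0 : 0 <= x / s h by rewrite divr_ge0 // ltW.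
have /andP[n1 n2] := truncn_itv xs0.
have nx : n%:R * s h <= x by rewrite -ler_pdivlMr.
have xn : x < n%:R * s h + s h.
  by rewrite -[X in _ + X]mul1r -mulrDl natr1 -ltr_pdivrMr.
have hd' : 0 < h <= d by rewrite h0.
have G (i : nat) : i%:R * s h <= x -> g (i%:R * s h, h) = h.
  elim: i => [|i IH]; first by rewrite mul0r norm.
  rewrite -natr1 mulrDl mul1r => ix.
  have i0 : 0 <= i%:R * s h by rewrite mulr_ge0 // ltW.
  rewrite inv // ?IH //; last exact: le_trans xd.
  by apply: le_trans ix; rewrite lerDl ltW.
exists (n%:R * s h), h; split => //.
- by rewrite mulr_ge0 ?(ltW s0) //=; exact: le_trans xd.
- have sheta : s h < eta by apply: He; rewrite he ltW.
  by rewrite ler0_norm; lra.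
- by rewrite h0.
- exact: G.
Qed.

(** Compactness of a segment of the axis gives the uniform bounds on the
    derivatives from which the decay is bootstrapped. *)
Lemma flat_near_axis S f D (d : R) : 0 < d -> partial_derivatives S f D ->
  (forall x h, 0 <= x <= d -> 0 <= h <= d -> S (x, h)) ->
  (forall i j x, 0 <= x < d -> D i j (x, 0) = 0) ->
  Cinfty (flat (box 0 (d / 2) d)) (box 0 (d / 2) d) f.
Proof.
move=> d0 HD HS D0; have d2 : d / 2 < d by lra.
pose X := [set x : R | 0 <= x <= d / 2].
have Xd x : X x -> 0 <= x <= d by move=> /andP[x0 xd]; rewrite x0 /= (le_trans xd) // ltW.
have BS : box 0 (d / 2) d `<=` S.
  move=> [x h] /boxP[/= /andP[x0 xd] /andP[h0 hd]]; apply: HS.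
    by apply: Xd; rewrite /X /= !ltW.
  by rewrite !ltW.
have decay : forall N i j, exists2 e : R, 0 < e &
    forall x h, X x -> 0 < h < e -> `|D i j (x, h)| <= h ^+ N.
  apply: (@vanishing_decay _ S D X d d0).
  - by move=> i j p Sp; have [_ _] := HD.2 i j; exact.
  - move=> x h /Xd xd /andP[h0 hd]; apply: HS => //; by rewrite h0 ltW.
  - move=> i j x /andP[x0 xd]; apply: D0; rewrite x0 /=; exact: le_lt_trans d2.
  - move=> i j; have [/continuous_withinP cD _ _] := HD.2 i j.
    have [|e e0 He] := @tube R (fun q => S q -> `|D i j q| <= 1) 0 (d / 2) 0.
      move=> x xd; have Sx : S (x, 0) by apply: HS; [exact: Xd|rewrite lexx ltW].
      have [a a0 Ha] := cD _ Sx 1 ltr01; apply/near_planeP; exists a => // q q1 q2 Sq.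
      have := Ha q Sq q1 q2; rewrite D0 ?subr0; first exact: ltW.
      by case/andP: xd => -> /=; move/le_lt_trans; apply.
    exists (Num.min e d); first by rewrite lt_min e0.
    move=> x h Xx /andP[h0]; rewrite lt_min => /andP[he hd].
    apply: He => //; first by rewrite subr0 gtr0_norm.
    by apply: HS; [exact: Xd|rewrite !ltW].
have FD i j : flat (box 0 (d / 2) d) (D i j).
  move=> N; have [e e0 H] := decay N i j; exists e => // -[x h] /boxP[/= /andP[x0 xd] _] he _.
  by apply: H => //; rewrite /X /= !ltW.
apply: (smooth_Cinfty (partial_derivatives_sub BS _ HD)) => //.
move=> N; have [e e0 H] := FD 0%N 0%N N; exists e => // p Wp h1 h2.
by rewrite -HD.1; [exact: H|exact: BS].
Qed.

(** Among the fundamental intervals [1, 2[ is chosen because its points and their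
    neighbours at distance less than 1 are in ]0, 3[, so that only positive
    values of tau = t s h are involved. *)
Definition representative (t : R) : R := t - (Num.floor t)%:~R + 1.

Definition periodize f p := f (representative p.1, p.2).

Lemma representative_itv t : 1 <= representative t < 2.
Proof.
have /andP[] := real_floor_itv (num_real t); rewrite intrD1 /representative => ? ?.
by apply/andP; split; lra.
Qed.

Definition periodic_on (eps : R) f :=
  forall t h, 0 < t < 2 -> 0 < h < eps -> f (t + 1, h) = f (t, h).

Lemma periodizeE (eps : R) f (m : int) t h : periodic_on eps f ->
  0 < t - m%:~R < 3 -> 0 < h < eps -> periodize f (t, h) = f (t - m%:~R, h).
Proof.
move=> per /andP[t0 t3] he; rewrite /periodize /=.
have /andP[r1 r2] := representative_itv t.
pose d := m - (Num.floor t - 1).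
have E : t - m%:~R = representative t - d%:~R.
  by rewrite /representative /d !rmorphB /=; ring.
have dlt : d < 2 by rewrite -(ltr_int R) (_ : 2%:~R = 2 :> R) //; lra.
have dgt : - 2 < d by rewrite -(ltr_int R) (_ : (-2)%:~R = - 2 :> R) //; lra.
have : d = -1 \/ d = 0 \/ d = 1 by lia.
rewrite E => -[->|[->|dE]].
- by rewrite mulrN1z opprK (per (representative t)) //; apply/andP; split; lra.
- by rewrite mulr0z subr0.
- move: t0 t3; rewrite E dE mulr1z => t0 t3.
  by rewrite -{1}(subrK 1 (representative t)) (per (representative t - 1)) //; apply/andP; split; lra.
Qed.

Lemma has_partial_translate b S f p l (z : R) :
  has_partial b S f (p.1 + z, p.2) l ->
  has_partial b [set q | S (q.1 + z, q.2)] (fun q => f (q.1 + z, q.2)) p l.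
Proof.
apply: dq_local; first by rewrite !shift0.
have E r : shift b (p.1 + z, p.2) r = ((shift b p r).1 + z, (shift b p r).2).
  by case: b; rewrite /shift //= addrAC.
by exists 1 => // r _ /= Sr; rewrite E.
Qed.

Definition uniformly_flat (eps : R) f := forall N : nat, exists2 d : R, 0 < d &
  forall p, open_strip eps p -> p.2 < d -> `|f p| <= p.2 ^+ N.

(** Locally the periodization is a translate of f by an integer, also across the
    jumps of the representative, where two translates coincide. The derivatives
    inherit the periodicity of f. *)
Lemma Cn_periodize (eps : R) n f : periodic_on eps f ->
  Cn (flat (box 0 3 eps)) (box 0 3 eps) n f ->
  Cn (uniformly_flat eps) (open_strip eps) n (periodize f).
Proof.
set W := box 0 3 eps.
have ufl u : flat W u -> uniformly_flat eps (periodize u).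
  move=> Fu N; have [d d0 H] := flat_weaken 1 N Fu.
  exists (Num.min d 2^-1); first by rewrite lt_min d0 invr_gt0 ltr0n.
  move=> p /andP[p0 pe]; rewrite lt_min => /andP[pd p2].
  have /andP[r1 r2] := representative_itv p.1.
  apply: (H (representative p.1, p.2)) => /=; last 2 first.
  - by rewrite p0.
  - rewrite expr1 ger0_norm; last by lra.
    apply: le_trans (_ : 2 * p.2 <= 1); last by lra.
    by rewrite ler_pM2r // ltW.
  - apply/boxP => /=; rewrite p0 pe; split => //; apply/andP; split; lra.
have near p : open_strip eps p -> exists2 m : int,
    p.1 - m%:~R = representative p.1 & forall q, open_strip eps q ->
    `|q.1 - p.1| < 1 -> W (q.1 - m%:~R, q.2) /\
    forall u, periodic_on eps u -> periodize u q = u (q.1 - m%:~R, q.2).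
  move=> Sp; exists (Num.floor p.1 - 1).
    by rewrite /representative rmorphB /=; ring.
  have E : p.1 - (Num.floor p.1 - 1)%:~R = representative p.1.
    by rewrite /representative rmorphB /=; ring.
  move=> q Sq; rewrite ltr_norml => /andP[q1 q2].
  have /andP[r1 r2] := representative_itv p.1.
  have q3 : 0 < q.1 - (Num.floor p.1 - 1)%:~R < 3 by apply/andP; split; lra.
  split; first by apply/boxP.
  by move=> u pu; rewrite {1}(surjective_pairing q) (periodizeE pu q3).
have cont u : periodic_on eps u -> {within W, continuous u} ->
    {within open_strip eps, continuous (periodize u)}.
  move=> pu /continuous_withinP cu; apply/continuous_withinP => p Sp e e0.
  have [m mE Hm] := near p Sp.
  have [|Wp Ep] := Hm p Sp; first by rewrite subrr normr0.
  have [d d0 Hd] := cu _ Wp e e0.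
  exists (Num.min d 1); first by rewrite lt_min d0 ltr01.
  move=> q Sq; rewrite !lt_min => /andP[q1 q1'] /andP[q2 _].
  have [Wq Eq] := Hm q Sq q1'; rewrite (Ep _ pu) (Eq _ pu).
  by apply: Hd => //=; rewrite opprB addrA subrK.
have perD b u v : (forall q, W q -> has_partial b W u q (v q)) ->
    periodic_on eps u -> periodic_on eps v.
  move=> Huv pu t h t2 he; have [t0 t2'] := andP t2.
  have Wt : W (t, h) by apply/boxP; split => //=; apply/andP; split; lra.
  have Wt1 : W (t + 1, h) by apply/boxP; split => //=; apply/andP; split; lra.
  apply: (has_partial_unique (@box_hopen _ _ _ _) Wt) (Huv _ Wt).
  have := @has_partial_translate b W u (t, h) _ 1 (Huv _ Wt1).
  apply: has_partial_local; first by rewrite /= pu.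
  exists (Num.min t (2 - t)); first by rewrite lt_min t0 subr_gt0.
  move=> [t' h'] /=; rewrite lt_min !ltr_norml => /andP[/andP[? ?] /andP[? ?]] _.
  move=> /boxP[/= /andP[? ?] he'].
  have t'2 : 0 < t' < 2 by apply/andP; split; lra.
  by split; [apply/boxP; split => //=; apply/andP; split; lra|exact: pu].
elim: n f => [|n IH] f pf Cf; split => //; try by [apply/ufl/(Cn_bound Cf)|
  apply: cont => //; exact: Cn_cont Cf].
case: Cf => _ _ [D HD]; exists (fun b => periodize (D b)) => b.
have [h1 k1] := HD b; have pD := perD _ _ _ h1 pf; split; last exact: IH.
move=> p Sp; have [m mE Hm] := near p Sp.
have [|Wp Ep] := Hm p Sp; first by rewrite subrr normr0.
rewrite (Ep _ pD); have := @has_partial_translate b W f p _ (- m%:~R) (h1 _ Wp).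
apply: has_partial_local; first by rewrite Ep.
exists 1 => // q q1 _ Sq; have [Wq Eq] := Hm q Sq q1.
by rewrite Eq.
Qed.

Lemma periodize_flat_function (eps : R) f : 0 < eps -> periodic_on eps f ->
  Cinfty (flat (box 0 3 eps)) (box 0 3 eps) f ->
  (forall h, 0 < h < eps -> f (1, h) = 0) ->
  flat_function eps (extend0 (periodize f)).
Proof.
move=> eps0 pf Cf f0.
have ext h : 0 <= h < eps -> h = 0 \/ 0 < h < eps.
  by move=> /andP[]; rewrite le_eqVlt => /orP[/eqP <-|->]; [left|right].
split => //.
- move=> t h /ext[->|he]; first by rewrite /extend0 ltxx.
  rewrite /extend0 /=; case: ifP => // _.
  have -> : periodize f (t, h) = f (t + 1 - (Num.floor t)%:~R, h).
    by rewrite /periodize /representative /= addrAC.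
  have /andP[r1 r2] := representative_itv t.
  apply: periodizeE he => //; rewrite /representative in r1 r2.
  by apply/andP; split; lra.
- move=> h /ext[->|he]; first by rewrite /extend0 ltxx.
  rewrite /extend0 /=; case: ifP => // _.
  by rewrite /periodize /representative /= floor0 subr0 add0r f0.
pose Q (u : R * R -> R) := forall e : R, 0 < e ->
  \forall h \near 0^'+, forall t, `|u (t, h)| < e.
have nearQ (u : R * R -> R) (e : R) : (exists2 d : R, 0 < d &
      forall t h, 0 < h < d -> `|u (t, h)| < e) ->
    (\forall h \near (0 : R)^'+, forall t, `|u (t, h)| < e).
  move=> [d d0 H]; rewrite near_withinE; apply/near_lineP; exists d => // h.
  by rewrite subr0 => hd h0 t; apply: H; rewrite h0; rewrite gtr0_norm in hd.
have CQ : Cinfty Q (strip eps) (extend0 (periodize f)).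
  move=> n; apply: Cn_extend0 (Cn_periodize pf (Cf n)).
  - exact: strip_hopen.
  - by move=> p /andP[_ pe] p0; apply/andP.
  - move=> u Hu N; have [d d0 H] := Hu N; exists d => // p Sp /andP[_ pd] _.
    exact: H.
  - move=> u Hu e e0; apply: nearQ; have [d d0 H] := Hu 1%N.
    exists (Num.min (Num.min d e) eps); first by rewrite !lt_min d0 e0.
    move=> t h /andP[h0]; rewrite !lt_min => /andP[/andP[hd he] heps].
    rewrite /extend0 /= h0; apply: le_lt_trans (H (t, h) _ hd) _ => //=.
    by rewrite /open_strip /= h0.
have [|D HD DQ] := Cinfty_smooth (@strip_hopen R eps) _ CQ; last by exists D.
move=> u v uv Qu e e0.
have near0 : \forall h \near (0 : R)^'+, 0 < h < eps.
  rewrite near_withinE; apply/near_lineP; exists eps => // h.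
  by rewrite subr0 => he h0; rewrite gtr0_norm // in he; rewrite h0.
apply: filterS2 (Qu e e0) near0 => h H /andP[h0 he] t.
by rewrite -uv //; apply/andP; rewrite /= ltW.
Qed.

Definition between_union (a b x : R) :=
  (0 <= x <= b) \/ (0 <= x <= a \/ a <= x <= 0).

Lemma between_union_convex (a b x y z : R) : between_union a b x ->
  between_union a b z -> x <= y <= z -> between_union a b y.
Proof.
rewrite /between_union => Px Pz /andP[xy yz].
have [y0|y0] := leP 0 y.
  case: Pz => [/andP[? ?]|[/andP[? ?]|/andP[? ?]]].
  - by left; apply/andP; split; lra.
  - by right; left; apply/andP; split; lra.
  - by right; right; apply/andP; split; lra.
case: Px => [/andP[? ?]|[/andP[? ?]|/andP[? ?]]]; [lra|lra|].
by right; right; apply/andP; split; lra.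
Qed.

(** Every germ of foliation comes from a flat function: normalize, observe that
    the difference with h is negligible at the axis because it vanishes on the
    orbits of (0, h), and read it off one period. *)
Lemma foliation_flat_function J U k : open J -> is_interval J -> J 0 ->
  invariant_foliation (@Fmap R c) J U k ->
  exists eps psi V, [/\ flat_function eps psi, V `<=` strip eps,
    invariant_foliation (@Fmap R c) J V (gfun c psi) &
    same_foliation_germ J V (gfun c psi) U k].
Proof.
move=> oJ iJ J0 HU.
have [S [g [[oS SU JS] [Cg ig g0 gJ] [b b0 norm] lev inv]]] := normal_form J0 HU.
have A0 : axis J (0, 0) by [].
have [_ [e e0 He]] := hopenP oS (JS _ A0).
pose d := Num.min e b / 2.
have [d0 [de db]] : 0 < d /\ d < e /\ d < b.
  have : 0 < Num.min e b by rewrite lt_min e0 b0.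
  have : Num.min e b <= e by rewrite ge_min lexx.
  have : Num.min e b <= b by rewrite ge_min lexx orbT.
  by rewrite /d; split; [|split]; lra.
clearbody d.
have HS x h : 0 <= x <= d -> 0 <= h <= d -> S (x, h).
  move=> /andP[x0 xd] /andP[h0 hd]; apply: He => //=.
    by rewrite subr0 ger0_norm //; exact: le_lt_trans de.
  by rewrite subr0 ger0_norm //; exact: le_lt_trans de.
have ginv x h : S (x, h) -> S (x + s h, h) -> g (x + s h, h) = g (x, h).
  by move=> S1 S2; exact: (inv (x, h)).
have norm' h : 0 <= h <= d -> g (0, h) = h.
  by move=> /andP[h0 hd]; apply: (norm h _).2; rewrite h0 /=; exact: le_lt_trans db.
pose f p := g p + -1 * p.2.
have Cf : Cinfty (@no_bound R) S f.
  move=> n; apply: (@CnD _ (@no_bound R) S n g (fun p => -1 * p.2)) => //.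
  by apply: (@CnM _ (@no_bound R) (@no_bound R)) => //; [exact: Cn_cst|exact: Cn_snd].
have [|D HD _] := Cinfty_smooth oS _ Cf; first by [].
have D0 : forall i j x, 0 <= x < d -> D i j (x, 0) = 0.
  apply: (zeros_vanishing d0 HD oS HS) => x eta xd eta0.
  have [||x' [h [H1 H2 H3 H4 H5]]] := @grid_zeros g d d0 _ _ x eta xd eta0.
  - move=> x1 h x10 xh /andP[h0 hd]; have sh := shift_length_gt0 c h0.
    have hd' : 0 <= h <= d by rewrite ltW.
    by apply: ginv; apply: HS => //; apply/andP; split; lra.
  - by move=> h /andP[h0 hd]; apply: norm'; rewrite ltW.
  - by exists x', h; split => //; rewrite /f /= H5 mulN1r subrr.
have Ff := flat_near_axis d0 HD HS D0.
have d6 : 0 < d / 6 by lra.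
have [e1 e10 He1] := shift_length_small c d6.
pose eps := Num.min e1 d; have eps0 : 0 < eps by rewrite lt_min e10 d0.
have [ee1 ed] : eps <= e1 /\ eps <= d by rewrite !ge_min !lexx orbT.
clearbody eps.
have sd h : 0 < h < eps -> 0 < s h < d / 6.
  move=> /andP[h0 he]; rewrite shift_length_gt0 //=; apply: He1.
  by rewrite ltW //=; exact: lt_le_trans ee1.
pose F p := f (p.1 * s p.2, p.2).
have CF : Cinfty (flat (box 0 3 eps)) (box 0 3 eps) F.
  move=> n; have K := Cn_rescale (W' := box 0 3 eps) (@power_scale_shift R c)
    (@box_hopen R _ _ _) (@box_hopen R _ _ _) _ _ (Ff n).
  apply: K.
  - by move=> p /boxP[_ /andP[]].
  - move=> p /boxP[/andP[p0 p3] pe]; have /andP[s0 s6] := sd _ pe.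
    apply/boxP => /=; case/andP: pe => -> pe; rewrite (lt_le_trans pe ed) mulr_gt0 //.
    split => //; apply: (@lt_trans _ _ (3 * s p.2)); first by rewrite ltr_pM2r.
    by lra.
have inbox t h : 0 <= t <= 3 -> 0 < h < eps -> S (t * s h, h).
  move=> /andP[t0 t3] he; have /andP[s0 s6] := sd _ he.
  have t3s : t * s h <= 3 * s h by rewrite ler_pM2r.
  case/andP: he => h0 he; apply: HS.
    by rewrite mulr_ge0 ?(ltW s0) //=; lra.
  by rewrite ltW //= (ltW (lt_le_trans he ed)).
have pF : periodic_on eps F.
  move=> t h /andP[t0 t2] he; rewrite /F /f /=; congr (_ + _).
  have E : (t + 1) * s h = t * s h + s h by rewrite mulrDl mul1r.
  by rewrite E ginv // -?E; apply: inbox => //; apply/andP; split; lra.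
pose psi := extend0 (periodize F).
have Hpsi : flat_function eps psi.
  apply: periodize_flat_function => // h he; have /andP[h0 hd] := he.
  rewrite /F /f /= mul1r -[s h]add0r ginv ?norm' //.
  - by rewrite mulN1r subrr.
  - by rewrite ltW //= (ltW (lt_le_trans hd ed)).
  - by apply: HS; [rewrite lexx ltW|rewrite ltW //= (ltW (lt_le_trans hd ed))].
  - have := inbox 1 h _ he; rewrite mul1r add0r; apply; apply/andP; split; lra.
have [|V [aV VW star]] := @star_domain R J [set p | S p /\ p.2 < eps] oJ iJ J0.
  move=> x Jx; have [_ [a a0 Ha]] := hopenP oS (JS (x, 0) (conj Jx erefl)).
  apply/near_planeP; exists (Num.min a eps); first by rewrite lt_min a0.
  move=> q; rewrite !lt_min subr0 => /andP[q1 _] /andP[q2 q2'] q0.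
  rewrite gtr0_norm // in q2'; split => //; apply: Ha => //; last exact: ltW.
  by rewrite subr0.
have [oV _ V0 _ _] := aV.
have gE p : (V `|` axis J) p -> gfun c psi p = g p.
  move=> [Vp|Jp]; last by rewrite gJ // (gfun_axis c Hpsi) //; case: Jp.
  have p0 : 0 < p.2 := V0 _ Vp; have [Sp pe] := VW _ Vp.
  have he : 0 < p.2 < eps by rewrite p0.
  have /andP[s0 s6] := sd _ he.
  rewrite /gfun /psi /extend0 /= p0 /periodize /F /f /=.
  rewrite mulN1r addrC subrK.
  set t := p.1 / s p.2; have /andP[r1 r2] := representative_itv t.
  have tE : p.1 = t * s p.2 by rewrite /t divfK // gt_eqF.
  have rE : representative t * s p.2 = p.1 + (1 - Num.floor t)%:~R * s p.2.
    by rewrite tE /representative rmorphB /=; ring.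
  (* At the height of p the function is defined between 0 and p, and on the
     first three steps from 0: together these form an interval. *)
  pose P := between_union p.1 (3 * s p.2).
  have PS x : P x -> S (x, p.2).
    case=> [/andP[x0 x3]|xp]; last by apply: (VW (x, p.2) _).1; exact: star.
    have := inbox (x / s p.2) p.2 _ he; rewrite divfK ?gt_eqF //; apply.
    by rewrite divr_ge0 ?(ltW s0) //= ler_pdivrMr.
  rewrite rE (surjective_pairing p) /=.
  apply: (@invariant_shift (fun x => g (x, p.2)) P (s p.2)) => //.
  - exact: between_union_convex.
  - by move=> x Px Px1; apply: ginv; exact: PS.
  - right; have [x0|x0] := leP 0 p.1; [left|right]; rewrite lexx ?x0 //= ltW //.
  - rewrite -rE; left; apply/andP; split; last by rewrite ler_pM2r //; lra.
    by apply: mulr_ge0; [lra|exact: ltW].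
have VS : V `|` axis J `<=` S by move=> p [/VW[]|/JS].
have Veps : V `|` axis J `<=` strip eps.
  move=> p [Vp|[_ /= p0]]; rewrite /strip /= ?p0 ?lexx //.
  by have := V0 _ Vp; have [_ pe] := VW _ Vp => /= /ltW ->.
exists eps, psi, V; split => //.
- by move=> p Vp; apply: Veps; left.
- apply: invariant_foliationI => //.
  + have [|E HE _] := Cinfty_smooth (adjacent_hopen aV) _
      (gfun_Cinfty c Hpsi (adjacent_hopen aV) Veps); first by [].
    by exists E.
  + by move=> p Vp; rewrite gE; [apply: g0; apply: VS; left|left].
  + by move=> p [_ /= p0]; exact: gfun_axis Hpsi p0.
  + by apply: increasing_height_sub ig => // p /gE.
  + by move=> p /Veps pe _; exact: gfun_invariant Hpsi pe.
- have VU : V `<=` U.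
    move=> p Vp; have [//|[_ /= p0]] := SU _ (VS p (or_introl Vp)).
    by have := V0 _ Vp; rewrite /= p0 ltxx.
  exists V; split => //; apply: eq_levels_leaves => p q Vp Vq.
  by rewrite !gE //; apply: lev; exact: VS.
Qed.

End FromFoliations.

(** * The correspondence *)

Section Correspondence.
Variables (R : realType) (c : map_case).
Implicit Types (J : set R) (U V : set (R * R)) (k psi : R * R -> R).

Lemma same_germ_same_function J eps psi V eps' psi' V' : J 0 ->
  flat_function eps psi -> flat_function eps' psi' ->
  invariant_foliation (@Fmap R c) J V (gfun c psi) ->
  same_foliation_germ J V (gfun c psi) V' (gfun c psi') ->
  same_function_germ eps psi eps' psi'.
Proof.
move=> J0 H H' [_ [[sg _ gJ ig _] _]] G; apply: (gfun_determines H H').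
apply: germ_determines_function (smooth_on_cont sg) ig gJ _ G => //.
have [e0 _ _ _] := H; have [e'0 _ _ _] := H'.
exists (Num.min eps eps'); first by rewrite lt_min e0.
move=> h /andP[h0]; rewrite lt_min => /andP[he he'].
by split; [apply: gfun_normalized H _|apply: gfun_normalized H' _]; rewrite h0.
Qed.

(** One direction is uniqueness; for the other, two functions with the same germ
    define the same function on a smaller adjacent domain. *)
Lemma defines_germ_same_function J eps psi V eps' psi' U k :
  open J -> is_interval J -> J 0 ->
  flat_function eps psi -> flat_function eps' psi' -> V `<=` strip eps ->
  invariant_foliation (@Fmap R c) J V (gfun c psi) ->
  same_foliation_germ J V (gfun c psi) U k ->
  defines_germ c J eps' psi' U k <-> same_function_germ eps psi eps' psi'.
Proof.
move=> oJ iJ J0 H H' Veps FV G; split=> [[V' [V'eps FV' G']]|[e [e0 ee ee' E]]].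
  apply: (same_germ_same_function J0 H H' FV).
  exact: same_germ_trans oJ iJ J0 G (same_germ_sym G').
have aV : adjacent J V := FV.1.
have [|V' [aV' V'V _]] := @star_domain R J (V `&` [set p | p.2 < e]) oJ iJ J0.
  have [_ _ _ _ HV] := aV => x Jx; have := HV (x, 0) (conj Jx erefl).
  have near0 : \forall q \near (x, 0 : R), q.2 < e.
    apply/near_planeP; exists e => // q _; rewrite /= subr0.
    exact/le_lt_trans/ler_norm.
  apply: filterS2 near0 => q qe Vq q0; split => //.
  by case: (Vq (ltW q0)) => // -[_ /= q00]; rewrite q00 ltxx in q0.
have gE p : (V' `|` axis J) p -> gfun c psi p = gfun c psi' p.
  move=> [V'p|[_ /= p0]].
    have [Vp pe] := V'V _ V'p; rewrite /gfun; congr (_ + _); apply: E.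
    by have /andP[p0 _] := Veps _ Vp; apply/andP.
  by rewrite (gfun_axis c H p0) (gfun_axis c H' p0).
have V'sub : V' `<=` V by move=> p /V'V[].
exists V'; split.
- move=> p /V'V[Vp /= pe]; have /andP[p0 _] := Veps _ Vp.
  by apply/andP; split => //; exact: lt_le_trans ee'.
- exact: invariant_foliation_sub gE FV.
- apply: (same_germ_trans oJ iJ J0 _ G); apply: same_germ_restrict => //.
  by move=> p [[V'p _]|Jp]; rewrite gE //; [left|right].
Qed.

End Correspondence.

Theorem theorem1p31 (R : realType) (c : map_case) (J : set R)
    (Jopen : open J) (Jitv : is_interval J) (J0 : J 0) :
  (forall (U : set (R * R)) (k : R * R -> R),
     invariant_foliation (@Fmap R c) J U k ->
     exists (eps : R) (psi : R * R -> R),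
       [/\ flat_function eps psi,
           defines_germ c J eps psi U k &
           forall (eps' : R) (psi' : R * R -> R),
             flat_function eps' psi' ->
             (defines_germ c J eps' psi' U k <->
              same_function_germ eps psi eps' psi')]) /\
  (forall (eps : R) (psi : R * R -> R),
     flat_function eps psi ->
     exists (U : set (R * R)) (k : R * R -> R),
       [/\ invariant_foliation (@Fmap R c) J U k,
           defines_germ c J eps psi U k &
           forall (U' : set (R * R)) (k' : R * R -> R),
             invariant_foliation (@Fmap R c) J U' k' ->
             (defines_germ c J eps psi U' k' <->
              same_foliation_germ J U k U' k')]).
Proof.
split=> [U k HU|eps psi H].
  have [eps [psi [V [H Veps FV G]]]] := foliation_flat_function Jopen Jitv J0 HU.
  exists eps, psi; split => //; first by exists V.
  by move=> eps' psi' H'; exact: defines_germ_same_function Jopen Jitv J0 H H' Veps FV G.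
have [V Veps FV] := gfun_foliation c Jopen Jitv J0 H.
have aV : adjacent J V := FV.1.
exists V, (gfun c psi); split => //.
  by exists V; split => //; exact: same_germ_refl.
move=> U' k' _; split=> [[V' [_ [aV' _] G]]|G]; last by exists V.
apply: (same_germ_trans Jopen Jitv J0 _ G).
by apply: same_germ_restrict.
Qed.
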